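(* For every $n\ge 1$ there is a bijection between the set $\mathcal{DU}_{2n-1}(4123)$ and the set of shifted standard Young tableaux of shape $(n+1,n,n-1)$ such that, for every $\pi=\pi_1\pi_2\ldots\pi_{2n-1}\in\mathcal{DU}_{2n-1}(4123)$, the $(1,n+1)$-entry of the tableau corresponding to $\pi$ is equal to $3n-\pi_1$.
   Context: A permutation $\pi=\pi_1\cdots\pi_m$ of $[m]=\{1,\ldots,m\}$ is down-up alternating if $\pi_1>\pi_2<\pi_3>\pi_4<\cdots$; it avoids the pattern $4123$ if no subsequence $\pi_{i_1}\pi_{i_2}\pi_{i_3}\pi_{i_4}$ ($i_1<i_2<i_3<i_4$) satisfies $\pi_{i_2}<\pi_{i_3}<\pi_{i_4}<\pi_{i_1}$. $\mathcal{DU}_m(4123)$ is the set of $4123$-avoiding down-up alternating permutations of $[m]$. For a partition $\lambda=(\lambda_1>\lambda_2>\cdots)$ with distinct parts, the shifted Young diagram of shape $\lambda$ has $\lambda_i$ cells in row $i$, each row indented one cell to the right relative to the previous row (so row $i$ occupies columns $i,\ldots,i+\lambda_i-1$; a part equal to $0$ gives an empty row). A shifted standard Young tableau is a filling of this diagram with $1,\ldots,|\lambda|$, each used once, increasing along rows and down columns. The $(i,j)$-entry is the entry in row $i$, column $j$. *)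

(* Defs.v *)
From mathcomp Require Import all_boot all_fingroup.

Set Implicit Arguments.
Unset Strict Implicit.
Unset Printing Implicit Defensive.

(* A permutation of [m] is an element of 'S_m, hence indexed from 0: its k-th
   letter, in the 1-based convention, is one more than the image of k - 1.
   The value is 0, which is not a letter, unless 1 <= k <= m. *)
Definition letter (m : nat) (pi : 'S_m) (k : nat) : nat :=
  if [pick i : 'I_m | i.+1 == k] is Some i then (pi i).+1 else 0.

(* With 0-based positions the descents are at the even i. *)
Definition down_up (m : nat) (pi : 'S_m) : bool :=
  [forall i : 'I_m, forall j : 'I_m,
     (j == i.+1 :> nat) ==> (if odd i then pi i < pi j else pi j < pi i)].

Definition avoids_4123 (m : nat) (pi : 'S_m) : bool :=
  [forall i1 : 'I_m, forall i2 : 'I_m, forall i3 : 'I_m, forall i4 : 'I_m,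
     [&& i1 < i2, i2 < i3 & i3 < i4] ==>
       ~~ [&& pi i2 < pi i3, pi i3 < pi i4 & pi i4 < pi i1]].

Definition DU_4123 (m : nat) : {set 'S_m} :=
  [set pi | down_up pi && avoids_4123 pi].

(* The cell (i; j) is the j-th cell, from 0, of the i-th row, from 0, of the
   shifted diagram; its 1-based coordinates are [cell_row] and [cell_col]. *)
Definition cell (la : seq nat) : finType :=
  {i : 'I_(size la) & 'I_(nth 0 la i)}.

Definition cell_row (la : seq nat) (c : cell la) : nat := (tag c).+1.

Definition cell_col (la : seq nat) (c : cell la) : nat := cell_row c + tagged c.

(* The number written in the cell c is (T c).+1. *)
Definition filling (la : seq nat) : finType :=
  {ffun cell la -> 'I_(sumn la)}.

Definition shifted_standard (la : seq nat) (T : filling la) : bool :=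
  [&& [forall k, #|[set c | T c == k]| == 1],
      [forall c, forall d,
         (cell_row c == cell_row d) && (cell_col c < cell_col d) ==> (T c < T d)] &
      [forall c, forall d,
         (cell_col c == cell_col d) && (cell_row c < cell_row d) ==> (T c < T d)]].

Definition ShSYT (la : seq nat) : {set filling la} :=
  [set T | shifted_standard T].

(* The (i, j)-entry with 1-based coordinates, and 0 outside the diagram. *)
Definition entry (la : seq nat) (T : filling la) (i j : nat) : nat :=
  if [pick c | (cell_row c == i) && (cell_col c == j)] is Some c then (T c).+1 else 0.

(* Main.v *)
Require Import Defs.
From mathcomp Require Import all_boot all_fingroup.
From mathcomp Require Import zify.

Set Implicit Arguments.
Unset Strict Implicit.
Unset Printing Implicit Defensive.

(** Both families are grown by a recursion in n and compared fibre by fibre.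

    A down-up 4123-avoiding word is grown by prepending two letters.  Let e be
    its first letter (letters start at 0) and S the set of t with 0 < t < e such
    that t - 1 stands before t.  A valley a and a peak e' may be prepended iff
    a <= e, a < e' <= e + 2 and S does not meet the open interval (a, e' - 1);
    the new set is {t in S | t < a}, together with a + 1 if a + 1 < e'.

    A tableau is grown by adding a last column.  If A and B denote the numbers of
    entries exceeding the last entry of rows 1 and 2, the new pairs (A', B') are
    those with 0 < B' <= B + 1 and B' < A' <= A + 2.

    Put e = A - 1 and D = e - B.  Then the joint distributions of (e, D) and of
    (e, max S) satisfy the same recursion.  For max S this fails word by word,
    since a decrease of e uncovers the smaller elements of S.  It holds for the
    sums because the number mu(S) of words with given e and S obeys
    mu(S + y) = mu(S + (e-1)) + mu(S + (y-1) + (e-1)) for max S < y - 1 and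
    y < e - 1, and the same holds hereditarily for S |-> mu(S + (e-1)); this
    property is preserved by the two elementary moves [lower] and [raise] into
    which each step of the recursion factors. *)

(** * Measures on stacks *)

(* A set without two consecutive elements, contained in the open interval
   (0, e) and listed in decreasing order. *)
Fixpoint stack (e : nat) (S : seq nat) : bool :=
  if S is t :: S' then [&& 0 < t, t < e & stack t.-1 S'] else true.

Definition supported e (mu : seq nat -> nat) := forall S, ~~ stack e S -> mu S = 0.

Definition star e (mu : seq nat -> nat) := forall y S,
  stack e (y :: S) -> y.+1 < e ->
  mu (y :: S) = mu (e.-1 :: S) + mu (e.-1 :: y.-1 :: S).

Fixpoint balanced e (mu : seq nat -> nat) : Prop :=
  if e is e'.+2 then star e mu /\ balanced e' (fun S => mu (e'.+1 :: S)) else True.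

(* The move e -> e - 1, which forgets the element e - 1. *)
Definition lower e (mu : seq nat -> nat) S :=
  if stack e.-1 S then mu S + mu (e.-1 :: S) else 0.

(* The move f -> f + 2, which inserts some y > max S and then deletes y - 1. *)
Definition raise f (mu : seq nat -> nat) S :=
  if S is y :: S0 then
    if stack f.+2 S then mu S0 + mu (y.-1 :: S0) else 0
  else 0.

Lemma stackW e e' S : e <= e' -> stack e S -> stack e' S.
Proof. by case: S => //= t S le /and3P[-> h ->]; rewrite andbT /=; apply: leq_trans le. Qed.

Lemma balancedSS e mu : balanced e.+2 mu ->
  star e.+2 mu /\ balanced e (fun S => mu (e.+1 :: S)).
Proof. by []. Qed.

Lemma balanced_ext e mu nu : mu =1 nu -> balanced e mu -> balanced e nu.
Proof.
elim/ltn_ind: e mu nu => -[|[|e]] IH mu nu eqm //= [h1 h2]; split.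
  by move=> y S hs hy; rewrite -!eqm; apply: h1.
by apply: IH h2 => // S; apply: eqm.
Qed.

Lemma balanced_star e mu : balanced e mu -> star e mu.
Proof. by case: e => [|[|e]] //= []. Qed.

Lemma supported_cons e mu : supported e.+2 mu -> supported e (fun S => mu (e.+1 :: S)).
Proof. by move=> h S hS; apply: h => /=; rewrite (negbTE hS) !andbF. Qed.

Lemma supported_lower e mu : supported e.-1 (lower e mu).
Proof. by move=> S /negbTE hS; rewrite /lower hS. Qed.

Lemma supported_raise f mu : supported f.+2 (raise f mu).
Proof. by case=> [|y S] // /negbTE hS; rewrite /raise hS. Qed.

(** Since e - 2 and e - 1 never occur together, [star] at y = e - 2 says that the fibre of
    [lower e mu] over its largest element e - 2 is the lowering of the fibre of [mu] over e - 1.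
    This gives the hereditary clause by induction; the star identity follows by expanding every term
    with the star identities of [mu] and of that fibre. *)
Lemma balanced_lower e mu : supported e mu -> balanced e mu -> balanced e.-1 (lower e mu).
Proof.
elim/ltn_ind: e mu => -[|[|[|e]]] IH mu // sup /balancedSS[st bal].
rewrite -[e.+3.-1]/e.+2.
have sup1 := supported_cons sup.
have st1 := balanced_star bal.
split; last first.
  apply: balanced_ext (IH e.+1 _ _ sup1 bal) => // S.
  rewrite /lower /=; case: ifP => hS; last by rewrite ltnS ?leqnn.
  rewrite ltnS leqnn /=.
  rewrite (sup (e.+2 :: e.+1 :: S)) ?addn0; last by rewrite /= ltnn !andbF.
  symmetry; apply: (st e.+1 S) => /=; rewrite ?hS ?andbT; lia.
move=> y S /= /and3P[y0 ye hS] ye'.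
have hSe : stack e S by apply: stackW hS; lia.
have hSe1 : stack e.+1 S by apply: stackW hSe; lia.
rewrite /lower /= y0 ye hS hSe ltnS leqnn /=.
have zz : forall U, mu [:: e.+2, e.+1 & U] = 0 by move=> U; apply: sup; rewrite /= ltnn !andbF.
rewrite !zz !addn0.
rewrite (st y) /=; [|by rewrite y0 hS andbT; lia|lia].
rewrite (st e.+1 S) //=; [|by rewrite hSe andbT; lia].
(* For y = e the last term contains the consecutive elements e and e - 1 and vanishes; otherwise
   this is [star] for the fibre over e + 2. *)
have -> : mu [:: e.+2, y & S] = mu [:: e.+2, e & S] + mu [:: e.+2, e, y.-1 & S].
  have [ey|ney] := eqVneq y e.
    rewrite ey [X in _ + X]sup ?addn0 //= ; lia.
  by apply: (st1 y S) => /=; [rewrite y0 hS andbT|]; lia.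
case: ifP => hy.
  rewrite (st e.+1 (y.-1 :: S)) //=; [lia|by rewrite hy; lia].
rewrite (sup [:: e.+2, y.-1 & S]) ?(sup [:: e.+2, e, y.-1 & S]) //=; first lia.
all: move: hy; case: (stack y.-1.-1 S); rewrite ?andbF ?andbT //; lia.
Qed.

(** No stack in (0, f) contains f, so inserting f + 1 deletes nothing and the fibre of [raise f mu]
    over f + 1 is [mu] itself. The two summands in the definition of [raise] are then exactly the
    two terms required by [star]. *)
Lemma balanced_raise f mu : supported f mu -> balanced f mu -> balanced f.+2 (raise f mu).
Proof.
move=> sup bal; split; last first.
  apply: balanced_ext bal => S /=.
  rewrite ltnS leqnn /= (sup (f :: S)) /= ?ltnn ?andbF // addn0.
  by case: ifP => // /negbT /sup.
move=> y S hs hy; have /= := hs => /and3P[y0 ye hS].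
have zz : forall U, mu (f :: U) = 0 by move=> U; apply: sup; rewrite /= ltnn !andbF.
have hSf : stack f S by apply: stackW hS; lia.
rewrite /= y0 ye hS hSf ltnS leqnn /= !zz !addn0.
case: ifP => // /negbT h; congr (_ + _); apply: sup => /=.
by move: h; case: (stack _ S); rewrite ?andbF ?andbT; lia.
Qed.

(* The total mass of the stacks in (0, e); [top mu r] below is the mass of those
   with maximum r, where r = 0 stands for the empty stack. *)
Fixpoint tot e (mu : seq nat -> nat) : nat :=
  if e is e'.+1 then
    if e' is e''.+1 then tot e' mu + tot e'' (fun S => mu (e' :: S)) else mu [::]
  else mu [::].

Arguments tot : simpl never.

Lemma totSS e mu : tot e.+2 mu = tot e.+1 mu + tot e (fun S => mu (e.+1 :: S)).
Proof. by []. Qed.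

Definition top (mu : seq nat -> nat) r :=
  if r is r'.+1 then tot r' (fun S => mu (r :: S)) else mu [::].

Definition cum k mu := \sum_(r < k) top mu r.

(** [tot 0] still counts the empty stack, whence the maximum with 1. *)
Lemma tot_cum e mu : tot e mu = cum (maxn e 1) mu.
Proof.
elim: e => [|[|e] IH]; try by rewrite /cum big_ord_recr big_ord0.
rewrite totSS IH /cum !(maxn_idPl _) //.
by rewrite [RHS]big_ord_recr.
Qed.

Lemma eq_in_tot e mu nu :
  (forall S, stack e S -> mu S = nu S) -> tot e mu = tot e nu.
Proof.
elim/ltn_ind: e mu nu => -[|[|e]] IH mu nu h; try exact: h.
rewrite !totSS; congr (_ + _); apply: IH => // S hS; apply: h.
  by apply: stackW hS.
by rewrite /= hS ltnSn.
Qed.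

Lemma tot_split e mu nu : tot e (fun S => mu S + nu S) = tot e mu + tot e nu.
Proof.
elim/ltn_ind: e mu nu => -[|[|e]] IH mu nu //.
by rewrite !totSS !IH // addnACA.
Qed.

Lemma tot0 e mu : (forall S, mu S = 0) -> tot e mu = 0.
Proof.
by elim/ltn_ind: e mu => -[|[|e]] IH mu h; try exact: h; rewrite totSS !IH.
Qed.

Lemma tot_sum (I : Type) (r : seq I) (P : pred I) (F : I -> seq nat -> nat) e :
  tot e (fun S => \sum_(i <- r | P i) F i S) = \sum_(i <- r | P i) tot e (F i).
Proof.
elim: r => [|i r IH]; first by rewrite big_nil tot0 // => S; rewrite big_nil.
rewrite big_cons -IH; case: ifP => Pi.
  by rewrite -tot_split; apply: eq_in_tot => S _; rewrite big_cons Pi.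
by apply: eq_in_tot => S _; rewrite big_cons Pi.
Qed.

Lemma top_sum (I : Type) (r : seq I) (P : pred I) (F : I -> seq nat -> nat) k :
  top (fun S => \sum_(i <- r | P i) F i S) k = \sum_(i <- r | P i) top (F i) k.
Proof. by case: k => //= k; rewrite tot_sum. Qed.

Lemma eq_top mu nu k : mu =1 nu -> top mu k = top nu k.
Proof. by move=> h; case: k => [|k] /=; [apply: h | apply: eq_in_tot]. Qed.

Lemma tot_supported e mu : supported e mu -> tot e.+1 mu = tot e mu.
Proof.
case: e => // e h; rewrite totSS [X in _ + X]tot0 ?addn0 // => S.
by apply: h; rewrite /= ltnn ?andbF.
Qed.

Lemma top_supported e mu r : supported e mu -> 0 < r -> e <= r -> top mu r = 0.
Proof.
case: r => // r h _ le; apply: tot0 => S; apply: h => /=.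
by rewrite ltnNge le.
Qed.

(** Summed over S, the two terms of [star] are the masses of the stacks with maximum e + 1 whose
    next element is below y - 1, respectively equal to y - 1. For y = 1 the second kind does not
    exist. *)
Lemma top_penult e mu y : supported e.+2 mu -> balanced e.+2 mu -> 0 < y <= e ->
  top mu y = tot y (fun S => mu (e.+1 :: S)).
Proof.
move=> sup /balanced_star st; case: y => //= y ye.
have sup1 := supported_cons sup.
rewrite (@eq_in_tot _ _ (fun S => mu (e.+1 :: S) + mu [:: e.+1, y & S])); last first.
  by move=> S hS; rewrite st //= hS andbT; lia.
rewrite tot_split; case: y ye => [|y] ye.
  by rewrite [X in _ + X](_ : _ = 0) ?addn0 //; apply: sup; rewrite /= andbF.
rewrite totSS; congr (_ + _); apply: tot_supported => S hS; apply: sup1 => /=.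
by rewrite (negbTE hS) !andbF.
Qed.

(** Lowering shifts the distribution of the maximum down by one. By [top_penult] the mass with
    maximum r > 0 is that of maximum e - 1 and next element below r; the stacks that lose e - 1 and
    end with maximum r add the case of next element r, and together they give the mass of maximum r
    + 1. *)
Lemma top_lower e mu r : supported e mu -> balanced e mu -> r.+1 < e ->
  top (lower e mu) r = if r is 0 then top mu 0 + top mu 1 else top mu r.+1.
Proof.
case: e => [|[|e]] // sup bal re.
have sup1 := supported_cons sup.
have top_max : top mu e.+1 = tot e (fun S => mu (e.+1 :: S)) by [].
case: r re => [|r] re.
  rewrite /= /lower /=; case: e sup bal sup1 top_max re => [|e] sup bal sup1 tm re //.
  by rewrite -[mu [:: e.+2]]/(tot 1 (fun S => mu (e.+2 :: S))) -top_penult.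
have -> : top (lower e.+2 mu) r.+1 =
    top mu r.+1 + top (fun S => mu (e.+1 :: S)) r.+1.
  rewrite /= -tot_split; apply: eq_in_tot => S hS.
  by rewrite /lower /= hS andbT (_ : r.+1 < e.+1).
rewrite (top_penult sup bal) //.
(* In the second case the shifted maximum is e + 1 itself, to which [top_penult] does not apply; its
   mass is the whole fibre. *)
have [re'|re'] := ltnP r.+1 e.
  by rewrite (top_penult sup bal).
have -> : r.+1 = e by lia.
rewrite top_max [X in _ + X](top_supported sup1) ?addn0 //; lia.
Qed.

(** The inserted y becomes the maximum, and it can be inserted exactly into the stacks with maximum
    below y. *)
Lemma top_raise f mu y : supported f mu -> y <= f.+1 -> top (raise f mu) y = cum y mu.
Proof.
move=> sup; case: y => [|y] yf; first by rewrite /cum big_ord0.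
have -> : top (raise f mu) y.+1 = tot y mu + tot y (fun S => mu (y :: S)).
  rewrite /= -tot_split; apply: eq_in_tot => S hS.
  by rewrite /= hS andbT (_ : y.+1 < f.+2).
case: y yf => [|y] yf.
  rewrite /= [X in _ + X]sup // addn0 /cum big_ord_recr big_ord0 //.
rewrite -[cum _ _]/(cum (maxn y.+2 1) _) -tot_cum totSS; congr (_ + _).
apply: tot_supported => S hS; apply: sup => /=.
by rewrite (negbTE hS) !andbF.
Qed.

(** * Iterated lowering and the full step *)

Fixpoint trunc d e mu := if d is d'.+1 then trunc d' e.-1 (lower e mu) else mu.

Lemma supported_trunc d e mu : supported e mu -> supported (e - d) (trunc d e mu).
Proof.
elim: d e mu => [|d IH] e mu sup /=; first by rewrite subn0.
by rewrite subnS -subn1 subnAC subn1; apply: IH; apply: supported_lower.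
Qed.

Lemma balanced_trunc d e mu : supported e mu -> balanced e mu ->
  balanced (e - d) (trunc d e mu).
Proof.
elim: d e mu => [|d IH] e mu sup bal /=; first by rewrite subn0.
rewrite subnS -subn1 subnAC subn1; apply: IH; first exact: supported_lower.
exact: balanced_lower.
Qed.

Lemma cum_supported k e mu : supported e mu -> 0 < k -> e <= k -> cum k mu = tot e mu.
Proof.
move=> sup k0 ek; rewrite tot_cum /cum -!(big_mkord xpredT (top mu)).
have h : maxn e 1 <= k by lia.
rewrite (big_cat_nat (leq0n _) h) //= [X in _ + X]big1_seq ?addn0 // => r.
by rewrite mem_index_iota => /andP[_ /andP[hr _]]; apply: top_supported sup _ _ => //; lia.
Qed.

Lemma cum_lower e mu k : supported e mu -> balanced e mu -> 0 < k <= e.-1 ->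
  cum k (lower e mu) = cum k.+1 mu.
Proof.
move=> sup bal; elim: k => // k IH ke.
rewrite /cum big_ord_recr [RHS]big_ord_recr /= -!/(cum _ _) top_lower //; last lia.
case: k IH ke => [|k] IH ke; first by rewrite /cum big_ord0 big_ord_recr big_ord0.
by rewrite IH //; lia.
Qed.

Lemma tot_lower e mu : supported e mu -> balanced e mu -> tot e.-1 (lower e mu) = tot e mu.
Proof.
case: e => [|[|e]] sup bal.
- by rewrite /tot /lower /= (sup [:: 0]) ?addn0.
- by rewrite /tot /lower /= (sup [:: 0]) ?addn0.
by rewrite [LHS]tot_cum [RHS]tot_cum !(maxn_idPl _) // cum_lower //=.
Qed.

(** Each lowering shifts the cumulative index by one; once the index passes the support, the sum is
    the total mass, which lowering preserves. *)
Lemma cum_trunc d e mu k : supported e mu -> balanced e mu -> 0 < k -> d <= e ->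
  cum k (trunc d e mu) = cum (k + d) mu.
Proof.
elim: d e mu k => [|d IH] e mu k sup bal k0 de /=; first by rewrite addn0.
have supl := @supported_lower e mu; have ball := balanced_lower sup bal.
rewrite IH ?addnS //; last lia.
case: (leqP (k + d) e.-1) => h; first by apply: cum_lower => //; lia.
by rewrite (cum_supported supl) ?(cum_supported sup) ?tot_lower //; lia.
Qed.

(* The passage from first letter e to first letter e' <= e + 2: all elements of
   the stack that are at least e' - 1 are forgotten before the insertion. *)
Definition step e e' mu :=
  if e' == e.+2 then raise e mu
  else lower e'.+1 (raise e'.-1 (trunc (e.+1 - e') e mu)).

Lemma balanced_step e e' mu : 0 < e' <= e.+2 -> supported e mu -> balanced e mu ->
  balanced e' (step e e' mu).
Proof.
move=> h sup bal; rewrite /step; case: eqP => [->|ne]; first exact: balanced_raise.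
have ee : e - (e.+1 - e') = e'.-1 by lia.
have sup' := @supported_trunc (e.+1 - e') _ _ sup.
have bal' := @balanced_trunc (e.+1 - e') _ _ sup bal.
rewrite ee in sup' bal'; case: e' {h ne ee} sup' bal' => // e' /= sup' bal'.
  by apply: (@balanced_lower e'.+2); [exact: supported_raise | exact: balanced_raise].
Qed.

Lemma top_step e e' mu r : r < e' <= e.+2 -> supported e mu -> balanced e mu ->
  top (step e e' mu) r = cum (r + e.+2 - e') mu.
Proof.
move=> /andP[re h] sup bal; rewrite /step; case: eqP => [ee|ne].
  by rewrite ee top_raise // ?addnK //; lia.
have ee : e - (e.+1 - e') = e'.-1 by lia.
have sup' := @supported_trunc (e.+1 - e') _ _ sup.
have bal' := @balanced_trunc (e.+1 - e') _ _ sup bal.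
rewrite ee in sup' bal'; case: e' {ee} re h ne sup' bal' => // e' re h ne sup' bal' /=.
rewrite /= in sup' bal'.
rewrite (@top_lower e'.+2); [|exact: supported_raise|exact: balanced_raise|lia].
(* At r = 0 the lowering merges the maxima 0 and 1, and [raise] puts the empty sum [cum 0] at 0; so
   the formula is uniform in r. *)
have -> : (if r is 0 then top (raise e' (trunc (e - e') e mu)) 0 +
             top (raise e' (trunc (e - e') e mu)) 1
           else top (raise e' (trunc (e - e') e mu)) r.+1) = cum r.+1 (trunc (e - e') e mu).
  case: r re => [|r] re; rewrite !(top_raise sup') ?[cum 0 _]big_ord0 //; lia.
rewrite cum_trunc //; [congr cum; lia | lia].
Qed.

(** * Extensionality and linearity of the moves *)

Lemma eq_lower e mu nu : mu =1 nu -> lower e mu =1 lower e nu.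
Proof. by move=> h S; rewrite /lower !h. Qed.

Lemma eq_raise e mu nu : mu =1 nu -> raise e mu =1 raise e nu.
Proof. by move=> h [|y S] //=; rewrite !h. Qed.

Lemma eq_trunc d e mu nu : mu =1 nu -> trunc d e mu =1 trunc d e nu.
Proof. by elim: d e mu nu => //= d IH e mu nu h; apply: IH; apply: eq_lower. Qed.

Section Linearity.
Variables (I : Type) (r : seq I) (P : pred I).
Implicit Type F : I -> seq nat -> nat.
Local Notation sum F := (fun S => \sum_(i <- r | P i) F i S).

Lemma lower_sum F e S : lower e (sum F) S = \sum_(i <- r | P i) lower e (F i) S.
Proof. by rewrite /lower; case: ifP => _; rewrite ?big_split // big1. Qed.

Lemma raise_sum F e S : raise e (sum F) S = \sum_(i <- r | P i) raise e (F i) S.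
Proof.
case: S => [|y S]; rewrite /raise; first by rewrite big1.
by case: ifP => _; rewrite ?big_split // big1.
Qed.

Lemma trunc_sum F d e S : trunc d e (sum F) S = \sum_(i <- r | P i) trunc d e (F i) S.
Proof.
elim: d e F => //= d IH e F; rewrite -IH; apply: eq_trunc => S1.
exact: lower_sum.
Qed.

Lemma step_sum F e e' S : step e e' (sum F) S = \sum_(i <- r | P i) step e e' (F i) S.
Proof.
rewrite /step; case: eqP => _; first exact: raise_sum.
rewrite -lower_sum; apply: eq_lower => S1; rewrite -raise_sum.
by apply: eq_raise => S2; apply: trunc_sum.
Qed.

Lemma balanced_sum F e : (forall i, P i -> balanced e (F i)) -> balanced e (sum F).
Proof.
elim/ltn_ind: e F => -[|[|e]] IH F h //; split.
  move=> y S hs hy; rewrite -big_split /=; apply: eq_bigr => i Pi.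
  exact: (proj1 (balancedSS (h i Pi))).
by apply: IH => // i Pi; apply: (proj2 (balancedSS (h i Pi))).
Qed.

End Linearity.

(** * The moves on point masses *)

Definition dirac (S S1 : seq nat) : nat := S1 == S.

Definition admissible a e' (S : seq nat) := all (fun t => ~~ (a < t < e'.-1)) S.

Definition child a e' (S : seq nat) :=
  (if a.+1 < e' then [:: a.+1] else [::]) ++ [seq t <- S | t < a].

Lemma stack_all e S : stack e S -> all (fun t => 0 < t < e) S.
Proof.
elim: S e => //= t S IH e /and3P[-> te /IH h] /=; rewrite te /=.
by apply: sub_all h => u; lia.
Qed.

Lemma filter_stack e e' S : stack e S -> e <= e' -> [seq t <- S | t < e'] = S.
Proof.
move=> /stack_all h le; apply/all_filterP; apply: sub_all h => u; lia.
Qed.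

Lemma stack_filter e e' S : stack e S -> stack e' [seq t <- S | t < e'].
Proof.
elim: S e e' => //= t S IH e e' /and3P[t0 te hS].
have [lt|ge] := ltnP t e'; last exact: IH hS.
rewrite /= t0 lt (@filter_stack t.-1) //; lia.
Qed.

Lemma dirac_out e S S1 : stack e S -> ~~ stack e S1 -> dirac S S1 = 0.
Proof. by rewrite /dirac; case: eqP => // -> ->. Qed.

Lemma lower_dirac e S : stack e S -> lower e (dirac S) =1 dirac [seq t <- S | t < e.-1].
Proof.
move=> hS S1; rewrite /lower; case: ifPn => h1; last first.
  by rewrite (@dirac_out e.-1) //; apply: stack_filter hS.
case: S hS => [|t S]; first by rewrite /dirac /= addn0.
move=> /= /and3P[t0 te hS].
rewrite (@filter_stack _ _ _ hS); last lia.
rewrite /dirac eqseq_cons.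
have [lt|ge] := ltnP t e.-1.
  by rewrite (_ : (e.-1 == t) = false) ?addn0 //; lia.
rewrite (_ : (e.-1 == t)) /=; last lia.
rewrite (_ : (S1 == t :: S) = false) //; apply/eqP => E.
by move: h1; rewrite E /=; lia.
Qed.

Lemma trunc_dirac d e S : stack e S -> trunc d e (dirac S) =1 dirac [seq t <- S | t < e - d].
Proof.
elim: d e S => [|d IH] e S hS S1 /=; first by rewrite subn0 (filter_stack hS).
rewrite (eq_trunc _ _ (lower_dirac hS)) IH; last exact: stack_filter hS.
congr (dirac _ _); rewrite -filter_predI; apply: eq_filter => t /=; lia.
Qed.

(** With y = a + 1, the condition [head 0 S <= a] says that y exceeds the maximum, 0 standing for
    that of the empty stack; the filter t < a deletes y - 1 = a. *)
Lemma raise_dirac f S S' : stack f S -> raise f (dirac S) S' =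
  \sum_(0 <= a < f.+1) ((head 0 S <= a) && (S' == a.+1 :: [seq t <- S | t < a])).
Proof.
move=> hS; case: S' => [|y S0]; first by rewrite big1 // => a _; rewrite andbF.
case: y => [|y].
  by rewrite /= big1 // => a _; rewrite eqseq_cons /= andbF.
rewrite /raise.
have [yf|yf] := leqP y f; last first.
  rewrite /= (_ : (y.+1 < f.+2) = false) /=; last lia.
  rewrite big_seq big1 // => a; rewrite mem_index_iota eqseq_cons => h.
  rewrite (_ : (y.+1 == a.+1) = false) ?andbF //; lia.
rewrite (bigD1_seq y) ?iota_uniq ?mem_index_iota //= eqseq_cons eqxx /=.
rewrite [X in _ = _ + X]big1 ?addn0 => [|a ay]; last first.
  by rewrite eqseq_cons (_ : (y.+1 == a.+1) = false) ?andbF //; lia.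
rewrite ltnS ltnS yf /=; case: S hS => [|t S] /=.
  by rewrite /dirac; case: S0 => //= *; rewrite ?addn0; case: ifP.
move=> /and3P[t0 tf hS].
have [ty|ty] := ltnP t y.
  rewrite (filter_stack hS); last lia.
  rewrite (ltnW ty) /= /dirac eqseq_cons.
  rewrite (_ : (y == t) = false) /= ?addn0; last lia.
  case: eqP => [->|_]; last by case: ifP.
  by rewrite /= t0 ty hS.
have [ety|nty] := eqVneq t y.
  rewrite ety leqnn /= (@filter_stack y.-1) -?ety; [|done|lia].
  rewrite /dirac eqseq_cons eqxx /=.
  case: ifP => hS0; last first.
    by case: eqP => // E; move: hS0; rewrite E (stackW _ hS) //; lia.
  rewrite (_ : (S0 == t :: S) = false) //; apply/eqP => E.
  by move: hS0; rewrite E ?ety /= ltnn andbF.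
rewrite (_ : (t <= y) = false) /=; last lia.
case: ifP => // h0; rewrite /dirac eqseq_cons (_ : (y == t) = false) ?addn0; last lia.
case: eqP => // E; move: h0; rewrite E /=; lia.
Qed.

(** This ties the moves to the prepending rule. For e' <= e + 1, truncation and [raise] allow every
    a up to e' - 1, and the final [lower] forgets the element e', so that a = e' - 1 yields the
    child without insertion. For e' = e + 2 the bound a <= e already keeps a + 1 below e'. *)
Lemma step_dirac e e' S S' : stack e S -> 0 < e' <= e.+2 -> step e e' (dirac S) S' =
  \sum_(0 <= a < e.+1) [&& a < e', admissible a e' S & S' == child a e' S].
Proof.
move=> hS /andP[e'0 e'e].
pose T := [seq t <- S | t < e'.-1].
have hT : stack e'.-1 T by apply: stack_filter hS.
(* Elements of S from e' - 1 on do not affect admissibility, so it only bounds the maximum of the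
   truncated stack. *)
have admE a : a < e' -> admissible a e' S = (head 0 T <= a).
  move=> ae; have -> : admissible a e' S = all (fun t => t <= a) T.
    rewrite all_filter; apply: eq_all => t /=; lia.
  case: T hT => //= t T1 /and3P[t0 te hT1].
  rewrite andb_idr // => ta.
  by apply: sub_all (stack_all hT1) => u; lia.
have chE a : a.+1 < e' -> child a e' S = a.+1 :: [seq t <- T | t < a].
  move=> ae; rewrite /child ae /= -filter_predI; congr (_ :: _).
  apply: eq_filter => t /=; lia.
rewrite /step; case: eqP => [ee|ne].
  have TS : T = S by rewrite /T (filter_stack hS) //; lia.
  rewrite raise_dirac // big_seq [RHS]big_seq; apply: eq_bigr => a.
  rewrite mem_index_iota => ha; rewrite admE ?chE ?TS; [|lia|lia].
  by rewrite (_ : a < e') //; lia.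
have ee : e - (e.+1 - e') = e'.-1 by lia.
have trE : trunc (e.+1 - e') e (dirac S) =1 dirac T.
  by move=> S1; rewrite trunc_dirac // ee.
rewrite (eq_lower _ (eq_raise _ trE)) /lower [e'.+1.-1]/=.
have {ee} -> : \sum_(0 <= a < e.+1) [&& a < e', admissible a e' S & S' == child a e' S]
   = \sum_(0 <= a < e') [&& a < e', admissible a e' S & S' == child a e' S].
  rewrite (@big_cat_nat _ _ _ e') //=; last lia.
  rewrite [X in _ + X]big1_seq ?addn0 // => a /andP[_].
  by rewrite mem_index_iota => /andP[h _]; rewrite ltnNge h.
case: e' e'0 e'e ne @T hT admE chE trE => // f _ fe ne T hT admE chE trE.
have rT : raise f (dirac T) (f.+1 :: S') = (S' == T).
  rewrite raise_dirac // big_nat_recr //= eqseq_cons eqxx /=.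
  rewrite big1_seq ?add0n => [|a /andP[_]]; last first.
    rewrite mem_index_iota => h; rewrite eqseq_cons.
    by rewrite (_ : (f.+1 == a.+1) = false) ?andbF //; lia.
  rewrite (@filter_stack f) // andb_idl // => /eqP _.
  case: (T) hT => //= t ? /and3P[]; lia.
rewrite [f.+1.-1]/= rT.
(* The last index a = f is the valley with a + 1 = e'; its child [T] matches the mass that [lower]
   takes from [f.+1 :: S']. *)
rewrite big_nat_recr //= ltnSn.
have -> : child f f.+1 S = T by rewrite /child ltnn.
have -> /= : admissible f f.+1 S by apply/allP => t _ /=; lia.
have -> : \sum_(0 <= i < f) [&& i < f.+1, admissible i f.+1 S & S' == child i f.+1 S] =
          \sum_(0 <= a < f) ((head 0 T <= a) && (S' == a.+1 :: [seq t <- T | t < a])).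
  rewrite big_seq [RHS]big_seq; apply: eq_bigr => a; rewrite mem_index_iota => ha.
  have af : a < f.+1 by lia.
  by rewrite admE ?chE ?af //; lia.
rewrite raise_dirac // big_nat_recr //=.
case: ifPn => hS'.
  congr (_ + _); rewrite (_ : (S' == f.+1 :: _) = false) ?andbF ?addn0 //.
  by apply/eqP => E; move: hS'; rewrite E /= ltnn.
rewrite (_ : (S' == T) = false); last first.
  by apply/eqP => E; move: hS'; rewrite E (stackW _ hT).
rewrite big1_seq // => a; rewrite mem_index_iota => /= ha.
rewrite (_ : (S' == _) = false) ?andbF //; apply/eqP => E; move: hS'; rewrite E /=.
by rewrite (stack_filter _ hT) andbT; lia.
Qed.

(** * Permutation words *)

(** The shift by [bump v] makes room for the value v and keeps the relative order of [w]. *)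
Definition ins v w := v :: map (bump v) w.

Fixpoint words m : seq (seq nat) :=
  if m is m'.+1 then [seq ins v w | w <- words m', v <- iota 0 m'.+1] else [:: [::]].

Arguments words : simpl never.

Definition pword m w := [/\ size w = m, uniq w & forall v, (v \in w) = (v < m)].

Lemma bump_inj v : injective (bump v).
Proof. by move=> i j; rewrite /bump; lia. Qed.

Lemma pword_ins m v w : v <= m -> pword m w -> pword m.+1 (ins v w).
Proof.
move=> vm [sz un mem]; split; first by rewrite /= size_map sz.
  rewrite /= map_inj_uniq ?un ?andbT; last exact: bump_inj.
  by apply/mapP => -[u _]; rewrite /bump; lia.
move=> u; rewrite inE; case: eqVneq => [->|ne] /=; first lia.
have -> : u = bump v (unbump v u) by rewrite unbumpK.
by rewrite mem_map ?mem; [rewrite /bump /unbump; lia | exact: bump_inj].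
Qed.

Lemma words_pword m w : w \in words m -> pword m w.
Proof.
elim: m w => [|m IH] w; first by rewrite inE => /eqP->.
case/allpairsP => -[u v] []; rewrite mem_iota => hu hv ->.
by apply: pword_ins; last exact: IH.
Qed.

Lemma pword_words m w : pword m w -> w \in words m.
Proof.
elim: m w => [|m IH] w [sz un mem]; first by rewrite (size0nil sz).
case: w sz un mem => // v w [sz]; rewrite cons_uniq => /andP[vw un] mem.
have vm : v < m.+1 by rewrite -mem mem_head.
have E : map (bump v) (map (unbump v) w) = w.
  rewrite -map_comp map_id_in // => u uw /=; apply: unbumpK.
  by rewrite inE; apply: contraNneq vw => <-.
apply/allpairsP; exists (map (unbump v) w, v); split; rewrite ?mem_iota //=; last by rewrite /ins E.
  apply: IH; split; first by rewrite size_map.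
    by rewrite -(map_inj_uniq (@bump_inj v)) E.
  move=> u; rewrite -(mem_map (@bump_inj v)) E.
  have := mem (bump v u); rewrite inE (_ : (bump v u == v) = false) /= => [->|].
    by rewrite /bump; lia.
  by rewrite /bump; lia.
Qed.

Lemma words_uniq m : uniq (words m).
Proof.
elim: m => // m IH; apply: allpairs_uniq; rewrite ?IH ?iota_uniq // => -[w v] [w' v'] _ _ /=.
by case=> <- /(inj_map (@bump_inj v)) ->.
Qed.

Lemma big_words m (F : seq nat -> nat) :
  \sum_(w <- words m.+1) F w = \sum_(w <- words m) \sum_(0 <= v < m.+1) F (ins v w).
Proof. exact: big_allpairs_dep. Qed.

(** * Alternation, avoidance and inverse ascents of words *)

Fixpoint alternating (d : bool) w : bool :=
  if w is x :: w' then
    (if w' is y :: _ then if d then y < x else x < y else true) && alternating (~~ d) w'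
  else true.

Lemma alternatingP d w : reflect (forall i, i.+1 < size w ->
    if d (+) odd i then nth 0 w i.+1 < nth 0 w i else nth 0 w i < nth 0 w i.+1)
  (alternating d w).
Proof.
elim: w d => [|x [|y w] IH] d; [by constructor|by constructor|].
apply: (iffP andP) => [[h /IH h'] [|i] /= hi|h].
- by case: d h {h'}.
- by have := h' i hi; case: d {h h'}; case: (odd i).
split; first by have := h 0 isT; case: d {h}.
by apply/IH => i hi; have := h i.+1 hi; case: d {h} => /=; case: (odd i).
Qed.

Lemma alternating_map f d w : {mono f : x y / x < y} ->
  alternating d (map f w) = alternating d w.
Proof.
move=> fm; elim: w d => //= x [|y w] IH d //.
by rewrite IH /= !fm.
Qed.

Lemma bump_mono v : {mono bump v : x y / x < y}.
Proof. by move=> x y; rewrite /bump; lia. Qed.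

Definition avoiding w := [forall i : 'I_(size w), forall j : 'I_(size w),
  forall k : 'I_(size w), forall l : 'I_(size w), [&& i < j, j < k & k < l] ==>
   ~~ [&& nth 0 w j < nth 0 w k, nth 0 w k < nth 0 w l & nth 0 w l < nth 0 w i]].

Lemma avoidingP w : reflect (forall i j k l, i < j -> j < k -> k < l -> l < size w ->
   nth 0 w j < nth 0 w k -> nth 0 w k < nth 0 w l -> nth 0 w l < nth 0 w i -> False)
  (avoiding w).
Proof.
apply: (iffP idP) => [h i j k l ij jk kl lw h1 h2 h3|h].
  have kw := ltn_trans kl lw; have jw := ltn_trans jk kw; have iw := ltn_trans ij jw.
  move: h => /forallP/(_ (Ordinal iw))/forallP/(_ (Ordinal jw)).
  move=> /forallP/(_ (Ordinal kw))/forallP/(_ (Ordinal lw)) /=.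
  by rewrite ij jk kl h1 h2 h3.
apply/forallP => i; apply/forallP => j; apply/forallP => k; apply/forallP => l.
apply/implyP => /and3P[ij jk kl]; apply/negP => /and3P[h1 h2 h3].
exact: (h i j k l).
Qed.

(* The set S of the header; it has no two consecutive elements t and t + 1, as
   otherwise the first letter followed by t - 1, t, t + 1 would form a 4123. *)
Definition inv_ascents w := [seq t <- rev (iota 1 (head 0 w).-1) | index t.-1 w < index t w].

Lemma mem_inv_ascents w t :
  (t \in inv_ascents w) = (0 < t < head 0 w) && (index t.-1 w < index t w).
Proof. by rewrite mem_filter mem_rev mem_iota andbC; congr (_ && _); lia. Qed.

Lemma sorted_inv_ascents w : sorted gtn (inv_ascents w).
Proof.
apply: sorted_filter; first by move=> x y z /= h1 h2; apply: ltn_trans h1.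
by rewrite rev_sorted; apply: iota_ltn_sorted.
Qed.

Lemma gtn_trans : transitive gtn.
Proof. by move=> x y z /= h1 h2; apply: ltn_trans h1. Qed.

Lemma sorted_stack e S : sorted gtn S -> {in S, forall t, 0 < t < e} ->
  {in S, forall t, t.+1 \notin S} -> stack e S.
Proof.
elim: S e => //= t S IH e pS hS nS.
have /andP[-> ->] /= := hS t (mem_head _ _).
have tS : all (fun u => u < t) S.
  by move: pS; rewrite (path_sortedE gtn_trans) => /andP[].
apply: IH; first exact: path_sorted pS.
  move=> u uS; have := hS u; rewrite inE uS orbT => /(_ isT) /andP[-> _] /=.
  have := allP tS u uS; have := nS u; rewrite !inE uS orbT => /(_ isT) /=; lia.
by move=> u uS; have := nS u; rewrite !inE uS orbT => /(_ isT); rewrite negb_or => /andP[].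
Qed.

(** * Prepending a peak and a valley *)

Section PrependTwo.
Variables (m : nat) (w : seq nat).
Hypothesis pw : pword m.+1 w.
Let e := head 0 w.

Let sz : size w = m.+1. Proof. by case: pw. Qed.
Let un : uniq w. Proof. by case: pw. Qed.
Let nth0 : nth 0 w 0 = e. Proof. by rewrite nth0. Qed.

Lemma head_pword : e <= m.
Proof. by case: pw => _ _ mem; rewrite -ltnS -mem -nth0 mem_nth // sz. Qed.

Let nthi v : v <= m -> (index v w < m.+1) * (nth 0 w (index v w) = v).
Proof.
move=> vm; have vw : v \in w by case: pw => _ _ ->.
by rewrite -sz index_mem nth_index.
Qed.

Let nth_neq i : 0 < i -> i < m.+1 -> nth 0 w i <> e.
Proof.
by move=> i0 im E; have := nth_uniq 0 _ _ un; move=> /(_ i 0); rewrite sz nth0 E eqxx; lia.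
Qed.

Lemma inv_ascents_stack : avoiding w -> stack e (inv_ascents w).
Proof.
move/avoidingP => av; apply: sorted_stack; first exact: sorted_inv_ascents.
  by move=> t; rewrite mem_inv_ascents => /andP[].
move=> t; rewrite !mem_inv_ascents => /andP[/andP[t0 te] h1]; apply/negP => /andP[te' /= h2].
have em := head_pword.
have [i1 n1] := @nthi t.-1 ltac:(lia); have [i2 n2] := @nthi t ltac:(lia).
have [i3 n3] := @nthi t.+1 ltac:(lia).
apply: (av 0 (index t.-1 w) (index t w) (index t.+1 w)) => //; rewrite ?sz ?nth0 ?n1 ?n2 ?n3 //.
- case: (posnP (index t.-1 w)) => // E; move: n1; rewrite E nth0; lia.
- lia.
Qed.

(** Along the values b, b + 1, ..., c the positions cannot decrease at every step. *)
Lemma ascent_between b c : b < c -> index b w < index c w ->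
  exists2 t, b < t <= c & index t.-1 w < index t w.
Proof.
elim: c => // c IH bc h.
have [h'|h'] := ltnP (index c w) (index c.+1 w); first by exists c.+1; rewrite //= bc /=.
have [E|ne] := eqVneq b c; first by move: h; rewrite E ltnNge h'.
have [||t ht ht'] := IH; [lia|by apply: leq_trans h _|].
by exists t => //; lia.
Qed.

Variables (a e' : nat).
Hypothesis (ae : a <= e) (ae' : a < e').
Let w2 := ins e' (ins a w).

Let w2_0 : nth 0 w2 0 = e'. Proof. by []. Qed.
Let w2_1 : nth 0 w2 1 = a. Proof. by rewrite /w2 /= /bump; lia. Qed.
Let w2_2 i : i < m.+1 -> nth 0 w2 i.+2 = bump e' (bump a (nth 0 w i)).
Proof. by move=> im; rewrite /w2 /= -map_comp (nth_map 0) ?sz. Qed.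
Let sz2 : size w2 = m.+3. Proof. by rewrite /= !size_map sz. Qed.

Lemma avoiding_ins2W : avoiding w2 -> avoiding w.
Proof.
move/avoidingP => av; apply/avoidingP => i j k l ij jk kl; rewrite sz => lm h1 h2 h3.
apply: (av i.+2 j.+2 k.+2 l.+2); rewrite ?sz2 // !w2_2 ?bump_mono //; lia.
Qed.

(** With letters of [w] named before the shift, the obstructions are e', a, e, e + 1 when e' > e +
    2, and e', a, t - 1, t for an inverse ascent t in the open interval (a, e' - 1). If a prepended
    letter plays the 4 while the other three letters lie in [w], then e can play the 4 instead. *)
Lemma avoiding_ins2 : avoiding w -> e' <= m.+2 ->
  avoiding w2 = (e' <= e.+2) && admissible a e' (inv_ascents w).
Proof.
move=> /avoidingP av e'm; have em := head_pword; apply/idP/andP.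
  move/avoidingP => av2; split.
    rewrite leqNgt; apply/negP => gt.
    have [i1 n1] := @nthi e.+1 ltac:(lia).
    apply: (av2 0 1 2 (index e.+1 w).+2); rewrite ?sz2 ?w2_0 ?w2_1 ?w2_2 ?n1 ?nth0 //.
    - rewrite !ltnS lt0n; apply/eqP => E; move: n1; rewrite E nth0; lia.
    - by rewrite /bump; lia.
    - by rewrite /bump; lia.
    - by rewrite /bump; lia.
  apply/allP => t; rewrite mem_inv_ascents => /andP[te h]; apply/negP => at'.
  have [i1 n1] := @nthi t.-1 ltac:(lia); have [i2 n2] := @nthi t ltac:(lia).
  apply: (av2 0 1 (index t.-1 w).+2 (index t w).+2); rewrite ?sz2 ?w2_0 ?w2_1 ?w2_2 ?n1 ?n2 //.
  - by rewrite /bump; lia.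
  - by rewrite /bump; lia.
  - by rewrite /bump; lia.
move=> [e'e adm]; apply/avoidingP => i j k l ij jk kl; rewrite sz2.
have w2S u : 1 < u -> u < m.+3 -> exists u', [/\ u = u'.+2, u' < m.+1 &
    nth 0 w2 u = bump e' (bump a (nth 0 w u'))].
  by case: u => [|[|u]] // _ hu; exists u; rewrite w2_2.
move=> lm.
have [l' [El l'm ->]] := w2S l ltac:(lia) ltac:(lia).
have [k' [Ek k'm ->]] := w2S k ltac:(lia) ltac:(lia).
have nl := @nth_neq l' ltac:(lia) l'm.
rewrite !bump_mono.
case: j ij jk => [|[|j]] // ij jk.
  have -> : i = 0 by lia.
  rewrite w2_1 w2_0 => h1 h2 h3.
  have kk : index (nth 0 w k') w = k' by rewrite index_uniq ?sz.
  have ll : index (nth 0 w l') w = l' by rewrite index_uniq ?sz.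
  (* The letter at l' is at most e because e' <= e + 2, and is not e, which stands first; hence t <
     e, as membership in [inv_ascents w] requires. *)
  have [|t ht ht'] := @ascent_between _ _ h2; first by rewrite kk ll; lia.
  have /allP/(_ t) := adm; rewrite mem_inv_ascents ht' andbT -/e.
  by move: h1 h3; rewrite /bump => h1 h3 hh; have := hh ltac:(lia); lia.
have jm : j < m.+1 by lia.
rewrite w2_2 // !bump_mono => h1 h2.
case: i ij => [|[|i]] ij.
- rewrite w2_0 => h3.
  have lt : nth 0 w l' < e by move: h3; rewrite /bump; lia.
  have j0 : 0 < j by case: (j) h1 => //; rewrite nth0; lia.
  by apply: (av 0 j k' l'); rewrite ?sz ?nth0 //; lia.
- rewrite w2_1 => h3.
  have lt : nth 0 w l' < e by move: h3; rewrite /bump; lia.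
  have j0 : 0 < j by case: (j) h1 => //; rewrite nth0; lia.
  by apply: (av 0 j k' l'); rewrite ?sz ?nth0 //; lia.
rewrite w2_2 ?bump_mono; last lia.
by move=> h3; apply: (av i j k' l'); rewrite ?sz //; lia.
Qed.

Let index2 t : t < e' -> index t w2 = (index t (ins a w)).+1.
Proof.
move=> te; have <- : index (bump e' t) (map (bump e') (ins a w)) = index t (ins a w).
  by rewrite index_map //; exact: bump_inj.
rewrite (_ : bump e' t = t); last by rewrite /bump; lia.
by rewrite /w2 {1}/ins [LHS]/= (_ : (e' == t) = false) //; lia.
Qed.

Let index1 t : index (bump a t) (ins a w) = (index t w).+1.
Proof.
rewrite /ins /= (_ : (a == bump a t) = false); last by rewrite /bump; lia.
by rewrite index_map //; exact: bump_inj.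
Qed.

(** The letter a precedes all letters of [w], so a + 1 becomes an inverse ascent and a is none. A
    larger t would come from t - 1 in [w], which is excluded by admissibility or, if t - 1 = e, by e
    standing first. *)
Lemma inv_ascents_ins2 : e' <= e.+2 -> admissible a e' (inv_ascents w) ->
  inv_ascents w2 = child a e' (inv_ascents w).
Proof.
move=> e'e adm; apply: (@irr_sorted_eq _ gtn gtn_trans) => [x| | |t].
- by rewrite /= ltnn.
- exact: sorted_inv_ascents.
- have hf : all (fun t => t < a) [seq t <- inv_ascents w | t < a].
    by rewrite all_filter; apply/allP => t _ /=; apply/implyP.
  have sf : sorted gtn [seq t <- inv_ascents w | t < a].
    by apply: sorted_filter (sorted_inv_ascents w); exact: gtn_trans.
  rewrite /child; case: ifP => // _; rewrite /= (path_sortedE gtn_trans) sf andbT.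
  by apply: sub_all hf => t /=; lia.
rewrite mem_inv_ascents mem_cat mem_filter mem_inv_ascents -/e.
have -> : (t \in if a.+1 < e' then [:: a.+1] else [::]) = (t == a.+1) && (a.+1 < e').
  by case: ifP; rewrite ?inE ?andbT ?andbF.
rewrite [head 0 w2]/=.
case: (boolP (0 < t < e')) => ht; rewrite ?andFb ?andTb; last first.
  apply/esym/norP; split; first lia.
  by apply/negP => /andP[ta /andP[h _]]; lia.
rewrite !index2; [|lia|lia].
rewrite ltnS.
case: (ltngtP t a) => cmp.
- rewrite (_ : t == a.+1 = false) ?orFb; last lia.
  have := index1 t; have := index1 t.-1.
  have -> : bump a t = t by rewrite /bump; lia.
  have -> : bump a t.-1 = t.-1 by rewrite /bump; lia.
  by move=> -> ->; rewrite ltnS (_ : 0 < t < e) //; lia.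
- rewrite orbF; have [E|ne] := eqVneq t a.+1.
    by rewrite E /= eqxx (_ : (a == a.+1) = false) /=; lia.
  apply/negP => h.
  have ut : bump a t.-1 = t by rewrite /bump; lia.
  have ut' : bump a t.-2 = t.-1 by rewrite /bump; lia.
  have ut2 : index t (ins a w) = (index t.-1 w).+1 by rewrite -index1 ut.
  have ut1 : index t.-1 (ins a w) = (index t.-2 w).+1 by rewrite -index1 ut'.
  rewrite ut2 ut1 ltnS in h.
  have [E|ne'] := eqVneq t.-1 e.
    have : index e w = 0 by rewrite -nth0 index_uniq ?sz.
    by rewrite -E => E'; move: h; rewrite E' ltn0.
  have /allP/(_ t.-1) := adm; rewrite mem_inv_ascents h andbT -/e.
  by move=> hh; have := hh ltac:(lia); lia.
- by rewrite cmp /= eqxx ltn0 (_ : a == a.+1 = false) //=; lia.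
Qed.

Lemma alternating_ins2 : alternating true w2 = alternating true w.
Proof.
have : 0 < size w by rewrite sz.
rewrite /w2; case E: (w) => [|x s] // _.
rewrite /ins [map (bump e') _]/= -map_comp.
rewrite -[LHS]/(((bump e' a < e') && ((bump e' a < (bump e' \o bump a) x) &&
  alternating true (map (bump e' \o bump a) (x :: s))))).
rewrite alternating_map; last by move=> u v /=; rewrite !bump_mono.
rewrite [(_ \o _) x]/= bump_mono.
have -> : a < bump a x by move: ae; rewrite /e E /= /bump; lia.
by rewrite (_ : bump e' a < e') // /bump; lia.
Qed.

End PrependTwo.

(** * The recursion for permutation words *)

Lemma sum_pred1 N A (X : pred nat) : \sum_(0 <= a < N) ((a == A) && X a) = (A < N) && X A :> nat.
Proof.
have [lt|ge] := ltnP A N; last first.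
  rewrite big1_seq // => a; rewrite mem_index_iota => /andP[_ h].
  by rewrite (_ : (a == A) = false) //; lia.
rewrite (bigD1_seq A) ?iota_uniq ?mem_index_iota //= eqxx big1 ?addn0 // => a.
by move/negbTE->.
Qed.

Lemma sum_by (I : eqType) (r : seq I) (P : pred I) (h F : I -> nat) N :
  {in r, forall i, P i -> h i < N} ->
  \sum_(i <- r | P i) F i = \sum_(0 <= e < N) \sum_(i <- r | P i && (h i == e)) F i.
Proof.
move=> hN.
under [RHS]eq_bigr do rewrite big_mkcondr.
rewrite exchange_big /= big_seq_cond [RHS]big_seq_cond; apply: eq_bigr => i /andP[ir Pi].
rewrite (bigD1_seq (h i)) ?iota_uniq ?mem_index_iota ?hN //= eqxx.
by rewrite big1 ?addn0 // => e; rewrite eq_sym => /negbTE->.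
Qed.

Definition du4123 w := alternating true w && avoiding w.

Lemma du4123_ins2 m w a v : pword m.+1 w -> v <= m.+2 ->
  du4123 (ins v (ins a w)) = [&& du4123 w, a <= head 0 w, a < v, v <= (head 0 w).+2 &
    admissible a v (inv_ascents w)].
Proof.
move=> pw vm; rewrite /du4123.
case: (boolP ((a <= head 0 w) && (a < v))) => [/andP[ae av]|h].
  rewrite (alternating_ins2 pw ae av) ae av /=.
  case: (alternating true w) => //=.
  case: (boolP (avoiding w)) => hw; first by rewrite (avoiding_ins2 pw ae av).
  by apply: contraNF hw; apply: (avoiding_ins2W pw).
have -> : alternating true (ins v (ins a w)) = false.
  apply: contraNF h; case: w pw => [|x s] [] // _ _ _ /= /andP[h1 /andP[h2 _]].
  by move: h1 h2; rewrite /bump; lia.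
by rewrite andFb; apply/esym; apply: contraNF h => /and5P[_ -> ->].
Qed.

Lemma du4123_stack m w : pword m.+1 w -> du4123 w -> stack (head 0 w) (inv_ascents w).
Proof. by move=> pw /andP[_ av]; apply: inv_ascents_stack pw av. Qed.

(** Every word of length m + 3 arises exactly once by prepending two letters; for a fixed peak e',
    the allowed valleys are what [step_dirac] sums over. *)
Lemma sum_du4123_ins2 m (e' : nat) (S' : seq nat) :
  \sum_(w <- words m.+3 | du4123 w) ((head 0 w == e') && (inv_ascents w == S')) =
  \sum_(w <- words m.+1 | du4123 w && (0 < e' <= (head 0 w).+2))
    step (head 0 w) e' (dirac (inv_ascents w)) S'.
Proof.
rewrite [LHS]big_mkcond big_words big_words [RHS]big_mkcond /=.
apply: eq_big_seq => w /words_pword pw.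
have em := head_pword pw; have sz : size w = m.+1 by case: pw.
pose X a := [&& du4123 w, a <= head 0 w, a < e', e' <= (head 0 w).+2,
   admissible a e' (inv_ascents w) & S' == child a e' (inv_ascents w)].
have inner a : \sum_(0 <= v < m.+3) (if du4123 (ins v (ins a w)) then
     nat_of_bool ((head 0 (ins v (ins a w)) == e') && (inv_ascents (ins v (ins a w)) == S')) else 0)
     = X a.
  transitivity ((e' < m.+3) && X a : nat); last first.
    (* The range of v costs nothing, since [X a] forces e' <= e + 2 <= m + 2, where e is the first
       letter of [w]. *)
    by congr nat_of_bool; rewrite andb_idl // => /and5P[_ _ _ h _]; lia.
  rewrite -(sum_pred1 m.+3 e' (fun=> X a)); apply: eq_big_seq => v.
  rewrite mem_index_iota => hv.
  rewrite (du4123_ins2 _ pw) ?[head 0 (ins _ _)]/=; last lia.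
  case: (eqVneq v e') => [->|ne]; last by case: ifP.
  rewrite /= /X; case: ifP => [/and5P[-> ae av ve adm]|hh].
    by rewrite ae av ve adm (inv_ascents_ins2 pw) //= eq_sym.
  apply/esym/eqP; rewrite eqb0; apply/negP.
  by move=> /and5P[h1 h2 h3 h4 /andP[h5 _]]; move: hh; rewrite h1 h2 h3 h4 h5.
rewrite (eq_bigr (fun a => (X a : nat)) (fun a _ => inner a)).
rewrite /X; case: (boolP (du4123 w)) => dw /=; last by rewrite big1.
have st := du4123_stack pw dw.
case: ifP => he; last first.
  rewrite big1 // => a _; apply/eqP; rewrite eqb0; apply/negP => /and5P[_ h1 h2 _ _].
  by move: he; lia.
rewrite step_dirac // (@big_cat_nat _ _ _ (head 0 w).+1) //=; last lia.
rewrite [X in _ + X]big1_seq ?addn0; last first.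
  by move=> a; rewrite mem_index_iota => /andP[_ /andP[h _]]; rewrite leqNgt h.
apply: eq_big_seq => a; rewrite mem_index_iota => ha.
by rewrite (_ : a <= head 0 w) 1?(andP he).2 //; lia.
Qed.

(* The reading word of a tableau of shape (n+1, n, n-1): each entry v is replaced
   by 3n - v, columns are read top to bottom from right to left, and the last
   three letters are the entries (1,2), (2,2), (1,1) in this order. *)
Fixpoint tabw w : bool :=
  match w with
  | a :: b :: c :: w' =>
    match w' with
    | [::] => b < a < c
    | a' :: b' :: c' :: _ => [&& c < b, b < a, a < a', b < b', c < c' & tabw w']
    | _ => false
    end
  | _ => false
  end.

(** * The recursion for tableau words *)

Lemma tabw_ind (P : seq nat -> Prop) :
  (forall a b c, b < a < c -> P [:: a; b; c]) ->
  (forall a b c a' b' c' s, [&& c < b, b < a, a < a', b < b' & c < c'] ->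
     tabw [:: a', b', c' & s] -> P [:: a', b', c' & s] -> P [:: a, b, c, a', b', c' & s]) ->
  forall w, tabw w -> P w.
Proof.
move=> P1 P2 w; have [n] := ubnP (size w); elim: n w => // n IH.
case=> [|a [|b [|c [|a' [|b' [|c' s]]]]]] // hn.
  by move=> /= ?; apply: P1.
rewrite -[tabw _]/[&& c < b, b < a, a < a', b < b', c < c' & tabw [:: a', b', c' & s]].
move=> /and5P[h1 h2 h3 h4 /andP[h5 h6]]; apply: P2 => //; first by rewrite h1 h2 h3 h4.
by apply: IH => //; move: hn => /=; lia.
Qed.

Lemma tabw_map f w : {mono f : x y / x < y} -> tabw (map f w) = tabw w.
Proof.
move=> fm; have [n] := ubnP (size w); elim: n w => // n IH.
case=> [|a [|b [|c [|a' [|b' [|c' s]]]]]] // hn; first by rewrite /= !fm.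
have := IH [:: a', b', c' & s] ltac:(by move: hn => /=; lia).
rewrite -[tabw (map f [:: a, b, c, a', b', c' & s])]/[&& f c < f b, f b < f a,
  f a < f a', f b < f b', f c < f c' & tabw (map f [:: a', b', c' & s])] => ->.
by rewrite !fm.
Qed.

Lemma tabw_lt w : tabw w -> nth 0 w 1 < nth 0 w 0.
Proof. by case: w => [|a [|b [|c [|a' [|b' [|c' s]]]]]] // => [/andP[]|/and3P[]]. Qed.

(** The smallest letter is the third one, or the second one if the word is a single triple; the
    minimum covers both cases. *)
Lemma tabw_min w : tabw w -> all (leq (minn (nth 0 w 1) (nth 0 w 2))) w.
Proof.
elim/tabw_ind: w / => [a b c /= h|a b c a' b' c' s /= h _ IH]; first lia.
case/and4P: IH => h1 h2 h3 h4.
have h5 : all (leq (minn b c)) s by apply: sub_all h4 => u; lia.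
by rewrite h5 andbT; lia.
Qed.

Lemma bumpG h i : h <= i -> bump h i = i.+1.
Proof. by rewrite /bump => ->. Qed.

(** A positive c would give c' > 0, hence b' = 0, and then b <= [bump c 0] = 0 contradicts c < b; so
    c = 0. The shift by c then adds 1 to the bound for b, and the shifts by c and b add 2 to the
    bound for a. *)
Lemma bump3_column a b c a' b' c' : b' < a' -> minn b' c' = 0 ->
  [&& bump a (bump b c) < bump a b, bump a b < a, a < bump a (bump b (bump c a')),
   bump a b < bump a (bump b (bump c b')),
   bump a (bump b c) < bump a (bump b (bump c c')) & true]
  = [&& true, c == 0, 0 < b <= b'.+1 & b < a <= a'.+2].
Proof.
move=> lt mn; rewrite !bump_mono.
have E : (bump a b < a) = (b < a) by rewrite /bump; lia.
rewrite E andbT.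
have [ba|ba] := ltnP b a; last by rewrite !andbF.
rewrite (_ : (bump b c < b) = (c < b)); last by rewrite /bump; lia.
rewrite (_ : (a < bump a (bump b (bump c a'))) = (a <= bump b (bump c a'))); last first.
  by rewrite {1}/bump; lia.
rewrite (_ : (b < bump b (bump c b')) = (b <= bump c b')); last by rewrite {1}/bump; lia.
rewrite (_ : (c < bump c c') = (c <= c')); last by rewrite /bump; lia.
have [c0|c0] := posnP c.
  rewrite c0 !(bumpG (leq0n _)).
  by have [bb|bb] := leqP b b'.+1; [rewrite bumpG; lia | lia].
by rewrite /= /bump; lia.
Qed.

Lemma tabw_ins3 m w a b c : pword m.+1 w ->
  tabw (ins a (ins b (ins c w))) =
  [&& tabw w, c == 0, 0 < b <= (nth 0 w 1).+1 & b < a <= (nth 0 w 0).+2].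
Proof.
move=> pw.
have fm : {mono (bump a \o (bump b \o bump c)) : x y / x < y}.
  by move=> x y /=; rewrite !bump_mono.
have -> : ins a (ins b (ins c w)) = [:: a, bump a b, bump a (bump b c) &
   map (bump a \o (bump b \o bump c)) w] by rewrite /ins /= -!map_comp.
set f := bump a \o _ in fm *; set x := bump a b; set y := bump a (bump b c).
case: w pw => [|a' [|b' [|c' s]]] pw; [by case: pw | by [] | by [] |].
have -> : tabw [:: a, x, y & map f [:: a', b', c' & s]] =
  [&& y < x, x < a, a < f a', x < f b', y < f c' & tabw (map f [:: a', b', c' & s])] by [].
rewrite tabw_map //; case: (boolP (tabw _)) => tw; last by rewrite !andbF.
have mn : minn b' c' = 0.
  have /allP/(_ 0) := tabw_min tw; rewrite leqn0 => h; apply/eqP; apply: h.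
  by case: pw => _ _ ->.
have := tabw_lt tw; rewrite [nth _ _ 1]/= [nth _ _ 0]/= => lt.
exact: bump3_column.
Qed.

Lemma sum_tabw_ins3 m (A B : nat) :
  \sum_(w <- words m.+4 | tabw w) ((nth 0 w 0 == A) && (nth 0 w 1 == B)) =
  \sum_(w <- words m.+1 | tabw w)
     [&& 0 < B <= (nth 0 w 1).+1, B < A & A <= (nth 0 w 0).+2].
Proof.
rewrite [LHS]big_mkcond 3!big_words [RHS]big_mkcond.
apply: eq_big_seq => w /words_pword pw.
have sz : size w = m.+1 by case: pw.
have nm i : i < m.+1 -> nth 0 w i < m.+1.
  by move=> hi; case: (pw) => _ _ mem; rewrite -mem mem_nth // sz.
pose X c b a := [&& tabw w, c == 0, 0 < b <= (nth 0 w 1).+1 & b < a <= (nth 0 w 0).+2].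
transitivity (\sum_(0 <= c < m.+2) ((c == 0) && X c B A) : nat).
  apply: eq_big_seq => c; rewrite mem_index_iota => hc.
  transitivity (\sum_(0 <= b < m.+3) ((b == B) && X c b A) : nat); last first.
    rewrite sum_pred1; congr nat_of_bool; rewrite /X.
    case: (boolP (tabw w)) => tw; rewrite ?andbF //=.
    have := tabw_lt tw; have := nm 0 isT; case: (c == 0); rewrite ?andbF //=; lia.
  apply: eq_big_seq => b; rewrite mem_index_iota => hb.
  transitivity (\sum_(0 <= a < m.+4) ((a == A) && ((b == B) && X c b a)) : nat); last first.
    rewrite sum_pred1; congr nat_of_bool; rewrite /X.
    case: (boolP (tabw w)) => tw; rewrite ?andbF //=.
    have := nm 0 isT; case: (c == 0); rewrite ?andbF //=; lia.
  apply: eq_big_seq => a; rewrite mem_index_iota => ha.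
  rewrite (tabw_ins3 _ _ _ pw) -/(X c b a); case: ifP => hX; last by rewrite !andbF.
  rewrite andbT -[nth 0 (ins _ _) 0]/a -[nth 0 (ins _ _) 1]/(bump a b); congr (nat_of_bool (_ && (_ == _))).
  by move: hX => /and4P[_ _ _]; rewrite /bump; lia.
rewrite sum_pred1 /X eqxx /= -andbA; by case: (tabw w).
Qed.

(** * Comparison of the two families *)

(** From here up to the counting lemma, n is one less than in the theorem. *)
Definition du_mass n e (S : seq nat) :=
  \sum_(w <- words n.*2.+1 | du4123 w && (head 0 w == e)) dirac (inv_ascents w) S.

Definition tab_mass n e D :=
  \sum_(w <- words (3 * n.+1) | tabw w) ((nth 0 w 0 == e.+1) && (nth 0 w 1 + D == e)).

Lemma supported_du_mass n e : supported e (du_mass n e).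
Proof.
move=> S hS; rewrite /du_mass big_seq_cond big1 // => w /andP[/words_pword pw /andP[dw /eqP he]].
by apply: dirac_out hS; rewrite -he; apply: du4123_stack pw dw.
Qed.

(** The range of e only has to exceed all first letters; [3 * n.+1] also covers A - 1 for the
    tableau words, so that both recursions can be compared over the same range. *)
Lemma du_massS n e' S' : du_mass n.+1 e' S' =
  \sum_(0 <= e < 3 * n.+1 | 0 < e' <= e.+2) step e e' (du_mass n e) S'.
Proof.
rewrite /du_mass doubleS big_mkcondr /=.
under eq_bigr => w _.
  have -> : (if head 0 w == e' then dirac (inv_ascents w) S' else 0) =
            (head 0 w == e') && (inv_ascents w == S') :> nat.
    by rewrite /dirac [S' == _]eq_sym; case: (head 0 w == e').
  over.
rewrite sum_du4123_ins2 (@sum_by _ _ _ (head 0) _ (3 * n.+1)); last first.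
  move=> w /words_pword pw _; have := head_pword pw; lia.
rewrite [RHS]big_mkcond; apply: eq_bigr => e _; case: ifP => he.
  rewrite step_sum; apply: eq_big => [w|w /andP[_ /eqP->]] //.
  by rewrite -andbA; congr (_ && _); case: eqP => [->|]; rewrite ?he ?andbF.
rewrite big1 // => w /andP[/andP[_ h] /eqP E]; by rewrite E he in h.
Qed.

Lemma cum_tab_mass n e k : \sum_(r < k) tab_mass n e r =
  \sum_(w <- words (3 * n.+1) | tabw w) ((nth 0 w 0 == e.+1) && (e - nth 0 w 1 < k)).
Proof.
rewrite exchange_big; apply: eq_bigr => w /tabw_lt lt.
have [E|] := eqVneq (nth 0 w 0) e.+1; last by rewrite big1.
rewrite -(big_mkord xpredT (fun r => nat_of_bool (true && (nth 0 w 1 + r == e)))) /=.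
rewrite (eq_bigr (fun r => nat_of_bool ((r == e - nth 0 w 1) && xpredT r))); last first.
  by move=> r _; congr nat_of_bool; rewrite andbT; lia.
by rewrite sum_pred1 andbT.
Qed.

Lemma tab_massS n e' D : tab_mass n.+1 e' D =
  \sum_(w <- words (3 * n.+1) | tabw w)
    [&& D < e', e' - D <= (nth 0 w 1).+1 & e' <= (nth 0 w 0).+1].
Proof.
rewrite /tab_mass (_ : 3 * n.+2 = (3 * n.+1).-1.+4); last lia.
have [le|gt] := leqP D e'; last first.
  rewrite !big1 // => w _; first by apply/eqP; rewrite eqb0; lia.
  by rewrite (_ : (_ == e') = false) ?andbF //; lia.
rewrite (eq_bigr (fun w => nat_of_bool ((nth 0 w 0 == e'.+1) && (nth 0 w 1 == e' - D)))).
  rewrite sum_tabw_ins3 (_ : (3 * n.+1).-1.+1 = 3 * n.+1); last lia.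
  by apply: eq_bigr => w _; congr nat_of_bool; lia.
by move=> w _; congr (nat_of_bool (_ && _)); lia.
Qed.

Lemma du_mass0 e S : du_mass 0 e S = (e == 0) && (S == [::]).
Proof.
rewrite /du_mass /= /words /= unlock /= /du4123.
have -> : avoiding [:: 0] by apply/avoidingP => i j k l ij jk kl /= l1 _ _ _; lia.
by rewrite /= eq_sym; case: (e == 0); rewrite /= ?addn0.
Qed.

Lemma tab_mass0 e D : tab_mass 0 e D = (e == 0) && (D == 0).
Proof.
rewrite /tab_mass -big_filter (_ : [seq w <- _ | _] = [:: [:: 1; 0; 2]]) //.
rewrite big_seq1 /=; congr nat_of_bool; lia.
Qed.

(** Balancedness is carried through the induction because [top_step] needs it. With A = e + 1 and B
    = e - D, the tableau bounds A' <= A + 2 and B' <= B + 1 become e' <= e + 2 and D < D' + e + 2 -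
    e', the latter being the cumulative bound of [top_step]. *)
Lemma du_mass_tab n e : balanced e (du_mass n e) /\
  forall D, top (du_mass n e) D = tab_mass n e D.
Proof.
elim: n e => [|n IH] e.
  have E := du_mass0 e; split.
    case: e E => // e E; apply: (@balanced_ext _ (fun=> 0)) => [S|]; first by rewrite E.
    by elim/ltn_ind: e.+1 {E} => -[|[|k]] IH //; split; [|apply: IH].
  move=> [|D]; rewrite tab_mass0; first by rewrite /top E eqxx.
  by rewrite andbF /top tot0 // => S; rewrite E andbF.
have supE := @supported_du_mass n; have supE' := @supported_du_mass n.+1.
split.
  apply: balanced_ext (fsym (du_massS n e)) _.
  by apply: balanced_sum => e0 he; apply: balanced_step => //; case: (IH e0).
move=> D; rewrite tab_massS.
(* For D >= e both sides vanish: a tableau needs B' = e - D > 0, a positive stack maximum lies below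
   e, and e = 0 is not a peak. *)
have [lt|ge] := ltnP D e; last first.
  rewrite big1 //; case: D ge => [|D] ge; last exact: top_supported (supE' e) _ _.
  by rewrite /top du_massS big_pred0 // => e0; lia.
rewrite (eq_top _ (du_massS n e)) top_sum.
rewrite (eq_bigr (fun e0 => \sum_(w <- words (3 * n.+1) | tabw w)
   ((nth 0 w 0 == e0.+1) && (e0 - nth 0 w 1 < D + e0.+2 - e)))); last first.
  move=> e0 /andP[h1 h2]; rewrite top_step //; last by case: (IH e0).
    by rewrite -cum_tab_mass; apply: eq_bigr => r _; case: (IH e0).
  by rewrite lt h2.
rewrite exchange_big /= big_seq_cond [RHS]big_seq_cond; apply: eq_bigr => w /andP[/words_pword pw tw].
have lt1 := tabw_lt tw.
have lt2 : nth 0 w 0 < 3 * n.+1.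
  by case: pw => sz _ mem; rewrite -mem mem_nth // sz; lia.
(* For a fixed tableau word only e0 = A - 1 contributes. *)
rewrite big_mkcond /= (eq_bigr (fun e0 => nat_of_bool ((e0 == (nth 0 w 0).-1) &&
  ((0 < e <= e0.+2) && (e0 - nth 0 w 1 < D + e0.+2 - e))))); last first.
  move=> e0 _; case: ifP => he /=; last by rewrite andbF.
  by congr (nat_of_bool (_ && _)); lia.
rewrite sum_pred1; congr nat_of_bool; lia.
Qed.

Lemma tot_dirac e S : stack e S -> tot e (dirac S) = 1.
Proof.
elim/ltn_ind: e S => -[|[|e]] IH S hS.
- by case: S hS => // t S /=; rewrite andbF.
- by case: S hS => // t S /=; lia.
rewrite totSS; case: S hS => [|t S].
  by rewrite IH // tot0.
move=> /= /and3P[t0 te hS].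
have [lt|ge] := ltnP t e.+1.
  rewrite IH /= ?t0 ?lt // tot0 // => S1; rewrite /dirac eqseq_cons.
  by rewrite (_ : (e.+1 == t) = false) //; lia.
have Et : t = e.+1 by lia.
rewrite (@eq_in_tot e _ (dirac S)); last by move=> S1 _; rewrite /dirac eqseq_cons Et eqxx.
have hS' : stack e S by rewrite Et in hS.
rewrite (IH e) // (@eq_in_tot e.+1 _ (fun=> 0)) ?tot0 //.
by move=> S1 h1; rewrite /dirac; case: eqP => // E; move: h1; rewrite E Et /= ltnn.
Qed.

(** Only the marginal in e is needed: each word contributes one stack to the total mass, and D runs
    through 0, ..., e. *)
Lemma count_du_tab n e :
  count (fun w => du4123 w && (head 0 w == e)) (words n.*2.+1) =
  count (fun w => tabw w && (nth 0 w 0 == e.+1)) (words (3 * n.+1)).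
Proof.
rewrite -!sum1_count.
have -> : \sum_(w <- words n.*2.+1 | du4123 w && (head 0 w == e)) 1 = tot e (du_mass n e).
  rewrite tot_sum big_seq_cond [RHS]big_seq_cond; apply: eq_bigr => w.
  move=> /andP[/words_pword pw /andP[dw /eqP he]].
  by rewrite tot_dirac // -he; apply: du4123_stack pw dw.
rewrite -(@cum_supported e.+1 e) //; last exact: supported_du_mass.
rewrite /cum (eq_bigr (fun r : 'I_e.+1 => tab_mass n e r)); last first.
  by move=> r _; case: (du_mass_tab n e).
rewrite cum_tab_mass [RHS]big_mkcondr; apply: eq_bigr => w _.
by case: eqP => //= _; rewrite ltnS leq_subr.
Qed.

(** * Permutations and tableaux as words *)

(** An element is sent to the one with the same index in the enumeration of the corresponding fibre.
    Nonemptiness matters only for the default values of [nth]. *)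
Lemma bij_of_fibers (X Y : finType) (s : X -> nat) (t : Y -> nat) :
  (forall k, #|[set x | s x == k]| = #|[set y | t y == k]|) ->
  exists f : X -> Y, bijective f /\ forall x, t (f x) = s x.
Proof.
move=> eqc.
case: (pickP {: X}) => [x0 _|X0]; last first.
  exists (fun x => match elimF idP (X0 x) isT return Y with end).
  have no (y : Y) : False.
    have : 0 < #|[set x | s x == t y]| by rewrite eqc card_gt0; apply/set0Pn; exists y; rewrite inE.
    by case/card_gt0P => x; have := X0 x.
  split; last by move=> x; have := X0 x.
  by exists (fun y => match no y with end) => z; [have := X0 z | case: (no z)].
have [y0 _] : exists y0 : Y, true.
  have : 0 < #|[set y | t y == s x0]| by rewrite -eqc card_gt0; apply/set0Pn; exists x0; rewrite inE.
  by case/card_gt0P => y _; exists y.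
pose fX k := enum [set x | s x == k]; pose fY k := enum [set y | t y == k].
have sz k : size (fX k) = size (fY k) by rewrite -!cardE.
have inX x : x \in fX (s x) by rewrite mem_enum inE.
have inY y : y \in fY (t y) by rewrite mem_enum inE.
pose f x := nth y0 (fY (s x)) (index x (fX (s x))).
pose g y := nth x0 (fX (t y)) (index y (fY (t y))).
have tf x : t (f x) = s x.
  have : f x \in fY (s x) by rewrite mem_nth // -sz index_mem.
  by rewrite mem_enum inE => /eqP.
have sg y : s (g y) = t y.
  have : g y \in fX (t y) by rewrite mem_nth // sz index_mem.
  by rewrite mem_enum inE => /eqP.
exists f; split => //; exists g => [x|y].
  by rewrite /g tf /f index_uniq ?nth_index ?enum_uniq // -sz index_mem.
by rewrite /f sg /g index_uniq ?nth_index ?enum_uniq // sz index_mem.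
Qed.

Lemma card_by_words (X : finType) (wd : X -> seq nat) (L : seq (seq nat)) (q : pred (seq nat)) :
  injective wd -> uniq L -> (forall x, wd x \in L) ->
  (forall w, w \in L -> exists x, wd x = w) ->
  #|[set x | q (wd x)]| = count q L.
Proof.
move=> inj un sub sur.
have pe : perm_eq (map wd (enum X)) L.
  apply: uniq_perm => //; first by rewrite map_inj_uniq ?enum_uniq.
  move=> w; apply/mapP/idP => [[x _ ->]|/sur[x <-]] //.
  by exists x; rewrite ?mem_enum.
rewrite -(seq.permP pe) count_map -sum1_card -sum1_count.
by rewrite big_enum_cond; apply: eq_bigl => x; rewrite !inE.
Qed.

Section PermutationWord.
Variables (m : nat) (p : 'S_m).

Definition perm_word : seq nat := [seq val (p i) | i <- enum 'I_m].

Lemma size_perm_word : size perm_word = m.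
Proof. by rewrite size_map size_enum_ord. Qed.

Lemma nth_perm_word (i : 'I_m) : nth 0 perm_word i = p i.
Proof. by rewrite (nth_map i) ?size_enum_ord // nth_ord_enum. Qed.

Lemma perm_word_pword : pword m perm_word.
Proof.
split; first exact: size_perm_word.
  by rewrite map_inj_uniq ?enum_uniq // => i j /val_inj /perm_inj.
move=> v; apply/mapP/idP => [[i _ ->]|vm] //=.
by exists (p^-1%g (Ordinal vm)); rewrite ?mem_enum //= permKV.
Qed.

Lemma down_up_word : down_up p = alternating true perm_word.
Proof.
apply/idP/alternatingP => [h i|h].
  rewrite size_perm_word => im.
  have := h => /forallP/(_ (Ordinal (ltnW im)))/forallP/(_ (Ordinal im)).
  rewrite /= eqxx -!nth_perm_word /=; by case: (odd i).
apply/forallP => i; apply/forallP => j; apply/implyP => /eqP ij.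
have := h i; rewrite -ij size_perm_word ltn_ord => /(_ isT).
by rewrite !nth_perm_word; case: (odd i).
Qed.

Lemma avoids_word : avoids_4123 p = avoiding perm_word.
Proof.
apply/idP/avoidingP => [h i j k l ij jk kl|h].
  rewrite size_perm_word => lm.
  have km := ltn_trans kl lm; have jm := ltn_trans jk km; have im := ltn_trans ij jm.
  move: h => /forallP/(_ (Ordinal im))/forallP/(_ (Ordinal jm)).
  move=> /forallP/(_ (Ordinal km))/forallP/(_ (Ordinal lm)).
  by rewrite -!nth_perm_word /= ij jk kl => /negP h h1 h2 h3; apply: h; rewrite h1 h2 h3.
apply/forallP => i; apply/forallP => j; apply/forallP => k; apply/forallP => l.
apply/implyP => /and3P[ij jk kl]; apply/negP => /and3P[h1 h2 h3].
by apply: (h i j k l) => //; rewrite ?size_perm_word ?nth_perm_word.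
Qed.

Lemma letter1_word : 0 < m -> letter p 1 = (head 0 perm_word).+1.
Proof.
move=> m0; rewrite /letter; case: pickP => [i /eqP[i0]|]; last by move/(_ (Ordinal m0)).
by rewrite -nth0 -nth_perm_word i0.
Qed.

End PermutationWord.

Lemma perm_word_inj m : injective (@perm_word m).
Proof. by move=> p q E; apply/permP => i; apply: val_inj; rewrite /= -!nth_perm_word E. Qed.

Lemma pword_perm m w : pword m w -> exists p : 'S_m, perm_word p = w.
Proof.
move=> [sz un mem].
have lt (i : 'I_m) : nth 0 w i < m by rewrite -mem mem_nth ?sz.
have inj : injective (fun i => Ordinal (lt i)).
  by move=> i j [] /eqP; rewrite nth_uniq ?sz // => /eqP /val_inj.
exists (perm inj); apply: (@eq_from_nth _ 0); first by rewrite size_perm_word sz.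
move=> i; rewrite size_perm_word => im.
by rewrite -[i]/(val (Ordinal im)) nth_perm_word permE.
Qed.

Lemma card_du_words m k : 0 < m ->
  #|[set p : {p : 'S_m | p \in DU_4123 m} | letter (val p) 1 == k.+1]| =
  count (fun w => du4123 w && (head 0 w == k)) (words m).
Proof.
move=> m0.
have -> : [set p : {p : 'S_m | p \in DU_4123 m} | letter (val p) 1 == k.+1] =
          [set p | (fun w => head 0 w == k) (perm_word (val p))].
  by apply/setP => p; rewrite !inE letter1_word.
transitivity (count (fun w => head 0 w == k) [seq w <- words m | du4123 w]); last first.
  by rewrite count_filter; apply: eq_count => w /=; rewrite andbC.
apply: (@card_by_words _ (fun p : {p : 'S_m | p \in DU_4123 m} => perm_word (val p)) _
  (fun w => head 0 w == k)).
- by move=> p q /perm_word_inj /val_inj.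
- exact: filter_uniq (words_uniq m).
- move=> [p hp] /=; rewrite mem_filter (pword_words (perm_word_pword p)) andbT.
  by move: hp; rewrite inE /du4123 down_up_word avoids_word.
move=> w; rewrite mem_filter => /andP[dw /words_pword /pword_perm[p E]].
have hp : p \in DU_4123 m by rewrite inE down_up_word avoids_word E.
by exists (exist _ p hp).
Qed.

(** * Cells of shifted diagrams and tableau words *)

Lemma cell_exists la i j : i < size la -> j < nth 0 la i ->
  exists c : cell la, cell_row c = i.+1 /\ cell_col c = i.+1 + j.
Proof.
move=> hi hj.
by exists (Tagged (fun i : 'I_(size la) => 'I_(nth 0 la i)) (Ordinal hj : 'I_(nth 0 la (Ordinal hi)))).
Qed.

Lemma cell_inj la (c d : cell la) : cell_row c = cell_row d -> cell_col c = cell_col d -> c = d.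
Proof.
case: c => i j; case: d => i' j'; rewrite /cell_col /cell_row /= => -[/val_inj E].
by subst i' => /addnI /val_inj ->.
Qed.

Lemma cell_bounds la (c : cell la) : [/\ 0 < cell_row c, cell_row c <= size la,
  cell_row c <= cell_col c & cell_col c < cell_row c + nth 0 la (cell_row c).-1].
Proof.
case: c => i j; rewrite /cell_col /cell_row /=; split=> //; first exact: leq_addr.
by rewrite ltn_add2l.
Qed.

Lemma tabwP n w : size w = 3 * n.+1 -> tabw w <-> [/\
   forall k, k < n -> nth 0 w (3 * k + 2) < nth 0 w (3 * k + 1) < nth 0 w (3 * k),
   forall k r, k < n -> r < 3 -> nth 0 w (3 * k + r) < nth 0 w (3 * k.+1 + r) &
   nth 0 w (3 * n + 1) < nth 0 w (3 * n) < nth 0 w (3 * n + 2)].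
Proof.
elim: n w => [|n IH] w; first by case: w => [|a [|b [|c [|]]]] //= _; split=> [h|[]].
rewrite (_ : 3 * n.+2 = (3 * n).+1.+2.+3); last lia.
case: w => [|a [|b [|c w']]] // [sw].
have {}IH := IH w' ltac:(lia).
have -> : tabw [:: a, b, c & w'] = [&& c < b, b < a, a < nth 0 w' 0, b < nth 0 w' 1, c < nth 0 w' 2 & tabw w'].
  by case: w' sw {IH} => [|? [|? [|? ?]]].
have sh k r : nth 0 [:: a, b, c & w'] (3 * k.+1 + r) = nth 0 w' (3 * k + r).
  by rewrite (_ : 3 * k.+1 + r = (3 * k + r).+3) //; lia.
have sh0 k : nth 0 [:: a, b, c & w'] (3 * k.+1) = nth 0 w' (3 * k).
  by rewrite -[3 * k.+1]addn0 sh addn0.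
split.
  move=> /and5P[h1 h2 h3 h4 /andP[h5 /IH[t1 t2 t3]]]; split.
  - by case=> [|k] hk; rewrite ?sh ?sh0 ?t1 //= h1 h2.
  - by case=> [|k] r hk hr; rewrite ?sh ?t2 //; case: r hr => [|[|[|]]].
  - by rewrite !sh sh0.
move=> [t1 t2 t3].
have /= /andP[-> ->] := t1 0 isT.
have /= -> := t2 0 0 isT isT; have /= -> := t2 0 1 isT isT; have /= -> := t2 0 2 isT isT.
apply/IH; split.
- by move=> k hk; have := t1 k.+1 hk; rewrite !sh sh0.
- by move=> k r hk hr; have := t2 k.+1 r hk hr; rewrite !sh.
- by move: t3; rewrite !sh sh0.
Qed.

Section TableauWord.
Variables (n : nat) (hn : 0 < n).
Let la := [:: n.+1; n; n - 1].

Let sum_la : sumn la = 3 * n. Proof. rewrite /la /=; lia. Qed.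

(** Columns from n + 1 down to 2 fill consecutive triples. Column 2 has only two cells, and the
    single cell of column 1 takes its third slot, the last position. *)
Definition cell_pos (c : cell la) : nat :=
  if cell_col c == 1 then (3 * n).-1 else 3 * (n.+1 - cell_col c) + (cell_row c).-1.

Let cellB (c : cell la) :
  [/\ 0 < cell_row c <= 3, cell_row c <= cell_col c & cell_col c <= n.+1].
Proof.
have [h1 h2 h3 h4] := cell_bounds c; split=> //.
by move: h1 h2 h3 h4; case: (cell_row c) => [|[|[|[|r]]]] //= *; lia.
Qed.

Let cellE r k : 0 < r <= 3 -> r <= k <= n.+1 -> exists c : cell la, cell_row c = r /\ cell_col c = k.
Proof.
move=> hr hk; have [||c [h1 h2]] := @cell_exists la r.-1 (k - r).
- by rewrite /la /=; lia.
- by move: hr hk; case: r => [|[|[|[|r]]]] //=; lia.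
by exists c; rewrite h1 h2; lia.
Qed.

Let pos_lt c : cell_pos c < 3 * n.
Proof. by have [] := cellB c; rewrite /cell_pos; case: eqP; lia. Qed.

Let pos_inj : injective cell_pos.
Proof.
move=> c d; have [hc1 hc2 hc3] := cellB c; have [hd1 hd2 hd3] := cellB d.
rewrite /cell_pos; case: eqP => Ec; case: eqP => Ed E; apply: cell_inj; lia.
Qed.

Let pos_sur k : k < 3 * n -> exists c, cell_pos c = k.
Proof.
move=> hk; have := divn_eq k 3; have := ltn_pmod k (isT : 0 < 3).
set q := k %/ 3; set r := k %% 3 => hr E.
case: (boolP ((q == n.-1) && (r == 2))) => h.
  have [||c [h1 h2]] := @cellE 1 1; [by []|lia|].
  by exists c; rewrite /cell_pos h2 /=; lia.
have [||c [h1 h2]] := @cellE r.+1 (n.+1 - q); [lia|lia|].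
by exists c; rewrite /cell_pos h1 h2; case: eqP => /=; lia.
Qed.

(** As [T c] is the entry minus one, the letter is 3n minus the entry, and the order is reversed. *)
Definition tab_word (T : filling la) : seq nat :=
  mkseq (fun k => if [pick c | cell_pos c == k] is Some c then (3 * n).-1 - T c else 0) (3 * n).

Lemma nth_tab_word T c : nth 0 (tab_word T) (cell_pos c) = (3 * n).-1 - T c.
Proof.
rewrite nth_mkseq ?pos_lt //; case: pickP => [d /eqP /pos_inj -> //|/(_ c)].
by rewrite eqxx.
Qed.

Let T_lt (T : filling la) c : T c < 3 * n. Proof. by rewrite -sum_la. Qed.

Let nth_tab_lt (T : filling la) c d :
  (nth 0 (tab_word T) (cell_pos d) < nth 0 (tab_word T) (cell_pos c)) = (T c < T d).
Proof. by rewrite !nth_tab_word; have := T_lt T c; have := T_lt T d; lia. Qed.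

Lemma tab_word_inj : injective tab_word.
Proof.
move=> T T' E; apply/ffunP => c; apply: ord_inj.
by have := nth_tab_word T c; rewrite E nth_tab_word; have := T_lt T c; have := T_lt T' c; lia.
Qed.

Let size_tab T : size (tab_word T) = 3 * n. Proof. by rewrite size_mkseq. Qed.

Lemma tab_word_pword (T : filling la) :
  [forall k, #|[set c | T c == k]| == 1] <-> pword (3 * n) (tab_word T).
Proof.
split=> [/forallP h|[_ un mem]].
  have Tinj c d : T c = T d -> c = d.
    move=> E; have /cards1P[x Ex] := h (T c).
    have : c \in [set c0 | T c0 == T c] by rewrite inE.
    have : d \in [set c0 | T c0 == T c] by rewrite inE E.
    by rewrite Ex !inE => /eqP-> /eqP->.
  split; first exact: size_tab.
    apply/(uniqP 0) => i j; rewrite !inE size_tab => /pos_sur[c <-] /pos_sur[d <-].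
    rewrite !nth_tab_word => E; congr cell_pos; apply: Tinj; apply: ord_inj.
    by have := T_lt T c; have := T_lt T d; lia.
  move=> v; apply/idP/idP => [/(nthP 0)[i]|hv].
    rewrite size_tab => /pos_sur[c <-] <-; rewrite nth_tab_word; lia.
  have hk : (3 * n).-1 - v < sumn la by rewrite sum_la; lia.
  have /cards1P[x Ex] := h (Ordinal hk).
  have : x \in [set c | T c == Ordinal hk] by rewrite Ex inE.
  rewrite inE => /eqP/(congr1 val) /= E.
  by apply/(nthP 0); exists (cell_pos x); rewrite ?size_tab // nth_tab_word E; lia.
apply/forallP => k; have hk : k < 3 * n by rewrite -sum_la.
have /(nthP 0)[i] : (3 * n).-1 - k \in tab_word T by rewrite mem; lia.
rewrite size_tab => /pos_sur[c <-]; rewrite nth_tab_word => E.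
apply/cards1P; exists c; apply/setP => d; rewrite !inE; apply/eqP/eqP => [Ed|->]; last first.
  by apply: ord_inj; have := T_lt T c; lia.
apply: pos_inj; apply/eqP; rewrite -(nth_uniq 0 _ _ un) ?size_tab // !nth_tab_word Ed; lia.
Qed.

Let rows_increase (T : filling la) := [forall c, forall d,
   (cell_row c == cell_row d) && (cell_col c < cell_col d) ==> (T c < T d)].
Let cols_increase (T : filling la) := [forall c, forall d,
   (cell_col c == cell_col d) && (cell_row c < cell_row d) ==> (T c < T d)].

Lemma tab_word_tabw T : rows_increase T && cols_increase T <-> tabw (tab_word T).
Proof.
have n1 : n = n.-1.+1 by lia.
have ss : size (tab_word T) = 3 * n.-1.+1 by rewrite size_tab -n1.
rewrite (tabwP ss).
set x := nth 0 (tab_word T).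
have pos2 c q r : cell_col c = n.+1 - q -> cell_row c = r.+1 -> q < n -> 3 * q + r = cell_pos c.
  by move=> h1 h2 h3; rewrite /cell_pos h1 h2; case: eqP; lia.
have pos1 c : cell_col c = 1 -> 3 * n.-1 + 2 = cell_pos c.
  by move=> h1; rewrite /cell_pos h1 /=; lia.
split=> [/andP[/forallP hr /forallP hc]|[t1 t2 t3]].
  have row c d : cell_row c = cell_row d -> cell_col c < cell_col d -> x (cell_pos d) < x (cell_pos c).
    by move=> h1 h2; rewrite /x nth_tab_lt; have /forallP/(_ d) := hr c; rewrite h1 eqxx h2.
  have col c d : cell_col c = cell_col d -> cell_row c < cell_row d -> x (cell_pos d) < x (cell_pos c).
    by move=> h1 h2; rewrite /x nth_tab_lt; have /forallP/(_ d) := hc c; rewrite h1 eqxx h2.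
  have [c11 [r11 k11]] := @cellE 1 1 isT ltac:(lia).
  have [c12 [r12 k12]] := @cellE 1 2 isT ltac:(lia).
  have [c22 [r22 k22]] := @cellE 2 2 isT ltac:(lia).
  have p11 := pos1 _ k11.
  have p12 : 3 * n.-1 = cell_pos c12 by rewrite -[LHS]addn0; apply: pos2 => //; lia.
  have p22 : 3 * n.-1 + 1 = cell_pos c22 by apply: pos2 => //; lia.
  have base : x (cell_pos c22) < x (cell_pos c12) < x (cell_pos c11).
    by rewrite col ?row //; lia.
  split; last by rewrite p11 p22 p12.
    move=> k hk.
    have [c1 [r1 k1]] := @cellE 1 (n.+1 - k) isT ltac:(lia).
    have [c2 [r2 k2]] := @cellE 2 (n.+1 - k) isT ltac:(lia).
    have [c3 [r3 k3]] := @cellE 3 (n.+1 - k) isT ltac:(lia).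
    have p1 : 3 * k = cell_pos c1 by rewrite -[LHS]addn0; apply: pos2 => //; lia.
    have p2 : 3 * k + 1 = cell_pos c2 by apply: pos2 => //; lia.
    have p3 : 3 * k + 2 = cell_pos c3 by apply: pos2 => //; lia.
    by rewrite p3 p2 p1 !col ?k1 ?k2 ?k3 ?r1 ?r2 ?r3.
  move=> k r hk hr3.
  have [c1 [r1 k1]] := @cellE r.+1 (n.+1 - k) ltac:(lia) ltac:(lia).
  rewrite (pos2 c1) //; last lia.
  have [le|gt] := leqP r.+1 (n - k).
    have [c2 [r2 k2]] := @cellE r.+1 (n - k) ltac:(lia) ltac:(lia).
    have -> : 3 * k.+1 + r = cell_pos c2 by apply: pos2 => //; lia.
    by apply: row; rewrite ?r1 ?r2 ?k1 ?k2; lia.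
  (* Here the cell is (3, 3), and the next letter in its slot belongs to (1, 1), in another row; the
     comparison passes through (2, 3), (2, 2) and (1, 2). *)
  have -> : 3 * k.+1 + r = cell_pos c11 by rewrite -p11; lia.
  have [c2 [r2' k2]] := @cellE 2 (n.+1 - k) isT ltac:(lia).
  have h1 : x (cell_pos c1) < x (cell_pos c2) by apply: col; lia.
  have h2 : x (cell_pos c2) < x (cell_pos c22) by apply: row; lia.
  by case/andP: base; lia.
have mono r q d : r < 3 -> q + d < n -> x (3 * q + r) <= x (3 * (q + d) + r).
  move=> hr; elim: d => [|d IH] hd; first by rewrite addn0.
  apply: leq_trans (IH ltac:(lia)) _; rewrite addnS; apply: ltnW; apply: t2 => //; lia.
have monoS r q q' : r < 3 -> q < q' -> q' < n -> x (3 * q + r) < x (3 * q' + r).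
  move=> hr h1 h2; apply: leq_trans (t2 q r _ hr) _; first lia.
  by have := @mono r q.+1 (q' - q.+1) hr ltac:(lia); rewrite subnKC.
have posE c : cell_col c <> 1 -> cell_pos c = 3 * (n.+1 - cell_col c) + (cell_row c).-1.
  by rewrite /cell_pos; case: eqP.
apply/andP; split; apply/forallP => c; apply/forallP => d; apply/implyP => /andP[/eqP E lt];
  rewrite -nth_tab_lt -/x; have [hc1 hc2 hc3] := cellB c; have [hd1 hd2 hd3] := cellB d.
  rewrite (posE d); last lia.
  (* The cell (1, 1) is not in the first slot of its triple, so row 1 reaches it through (1, 2) and
     the clause for the last triple. *)
  have [Ec|Ec] := eqVneq (cell_col c) 1.
    rewrite -(pos1 c) // -E (_ : (cell_row c).-1 = 0); last lia.
    have := @mono 0 (n.+1 - cell_col d) (n.-1 - (n.+1 - cell_col d)) isT ltac:(lia).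
    rewrite subnKC; last lia.
    by case/andP: t3; rewrite !addn0; lia.
  rewrite (posE c); last by apply/eqP.
  by rewrite E; apply: monoS; lia.
rewrite (posE d) ?(posE c); [|lia|lia].
have [E2|E2] := eqVneq (cell_col c) 2.
  have -> : n.+1 - cell_col d = n.-1 by lia.
  have -> : n.+1 - cell_col c = n.-1 by lia.
  have -> : (cell_row d).-1 = 1 by lia.
  have -> : (cell_row c).-1 = 0 by lia.
  by rewrite addn0; case/andP: t3.
rewrite -E; have /andP[] := t1 (n.+1 - cell_col c) ltac:(lia).
set q := n.+1 - cell_col c => h1 h2.
have [[-> ->]|[[-> ->]|[-> ->]]] : ((cell_row c).-1 = 0 /\ (cell_row d).-1 = 1) \/
   (((cell_row c).-1 = 0 /\ (cell_row d).-1 = 2) \/ ((cell_row c).-1 = 1 /\ (cell_row d).-1 = 2)) by lia.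
- by rewrite addn0.
- by rewrite addn0; apply: ltn_trans h1 h2.
- by [].
Qed.

Lemma pword_tab w : pword (3 * n) w -> exists T, tab_word T = w.
Proof.
move=> [sz un mem].
have lt (c : cell la) : (3 * n).-1 - nth 0 w (cell_pos c) < sumn la by rewrite sum_la; lia.
exists [ffun c => Ordinal (lt c)]; apply: (@eq_from_nth _ 0); first by rewrite size_tab sz.
move=> i; rewrite size_tab => /[dup] hi /pos_sur[c Ec]; rewrite -Ec nth_tab_word ffunE /=.
have : nth 0 w (cell_pos c) < 3 * n by rewrite -mem mem_nth // sz.
lia.
Qed.

Lemma entry_tab_word T : (entry T 1 n.+1 <= 3 * n) /\ 3 * n - entry T 1 n.+1 = nth 0 (tab_word T) 0.
Proof.
have [c [r1 k1]] := @cellE 1 n.+1 isT ltac:(lia).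
have p0 : cell_pos c = 0 by rewrite /cell_pos k1 r1; case: eqP; lia.
rewrite /entry; case: pickP => [d /andP[/eqP h1 /eqP h2]|/(_ c)]; last by rewrite r1 k1 !eqxx.
have -> : d = c by apply: cell_inj; rewrite ?r1 ?k1.
by rewrite -[X in nth _ _ X]p0 nth_tab_word; have := T_lt T c; lia.
Qed.

Lemma card_tab_words k :
  #|[set T : {T : filling la | T \in ShSYT la} | 3 * n - entry (val T) 1 n.+1 == k]| =
  count (fun w => tabw w && (nth 0 w 0 == k)) (words (3 * n)).
Proof.
have -> : [set T : {T : filling la | T \in ShSYT la} | 3 * n - entry (val T) 1 n.+1 == k] =
          [set T | (fun w => nth 0 w 0 == k) (tab_word (val T))].
  by apply/setP => T; rewrite !inE (entry_tab_word (val T)).2.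
transitivity (count (fun w => nth 0 w 0 == k) [seq w <- words (3 * n) | tabw w]); last first.
  by rewrite count_filter; apply: eq_count => w /=; rewrite andbC.
apply: (@card_by_words _ (fun T : {T : filling la | T \in ShSYT la} => tab_word (val T)) _
  (fun w => nth 0 w 0 == k)).
- by move=> T T' /tab_word_inj /val_inj.
- exact: filter_uniq (words_uniq _).
- move=> [T hT] /=; move: hT; rewrite inE => /andP[/tab_word_pword pw /tab_word_tabw tw].
  by rewrite mem_filter tw; apply: pword_words.
move=> w; rewrite mem_filter => /andP[tw /words_pword pw].
have [T E] := pword_tab pw.
have hT : T \in ShSYT la.
  rewrite inE; apply/andP; split; first by apply/tab_word_pword; rewrite E.
  by apply/tab_word_tabw; rewrite E.
by exists (exist _ T hT).
Qed.

End TableauWord.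

Theorem theorem2p9 (n : nat) (hn : 1 <= n) :
  exists f : { p : 'S_(2 * n - 1) | p \in DU_4123 (2 * n - 1)} ->
             {T : filling [:: n.+1; n; n - 1] | T \in ShSYT [:: n.+1; n; n - 1]},
    bijective f /\
    forall p : { p : 'S_(2 * n - 1) | p \in DU_4123 (2 * n - 1)},
      entry (val (f p)) 1 n.+1 = 3 * n - letter (val p) 1.
Proof.
(* Both statistics equal A = e + 1: the first letter counted from 1, and the first letter of the
   tableau word counted from 0. *)
have [|f [bf hf]] := @bij_of_fibers { p : 'S_(2 * n - 1) | p \in DU_4123 (2 * n - 1)}
  {T : filling [:: n.+1; n; n - 1] | T \in ShSYT [:: n.+1; n; n - 1]}
  (fun p => letter (val p) 1) (fun T => 3 * n - entry (val T) 1 n.+1).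
  move=> k; rewrite card_tab_words //; case: k => [|k].
    (* The fibre over 0 is empty on both sides: letters start at 1, and A > B. *)
    rewrite (_ : [set x | _] = set0); last first.
      by apply/setP => p; rewrite !inE letter1_word //; lia.
    rewrite cards0; apply/esym/eqP; rewrite eqn0Ngt -has_count; apply/hasPn => w _.
    by apply/negP => /andP[/tabw_lt + /eqP E]; rewrite E.
  rewrite card_du_words; last lia.
  have -> : 2 * n - 1 = n.-1.*2.+1 by lia.
  have -> : 3 * n = 3 * n.-1.+1 by lia.
  exact: count_du_tab.
exists f; split=> // p.
(* The bound of the entry by 3n allows the truncated subtraction to be inverted. *)
by rewrite -hf; have [h _] := entry_tab_word hn (val (f p)); rewrite subKn.
Qed.
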